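(* Let $E=E^0\oplus E^1$ be the graded vector bundle over $S^2$ which is the trivial line bundle $S^2\times\mathbb{R}$ in degrees $0$ and $1$, equipped with the structure of a representation up to homotopy of the Lie algebroid $TS^2$ given by the operator $D=d+\eta$, where $\eta\in\Omega^2(S^2)$ is a volume form, viewed as an element of $\Omega^2(S^2,\mathrm{Hom}(E^1,E^0))$. Let $G=S^2\times S^2$ be the pair groupoid (the source simply connected Lie groupoid integrating $TS^2$). Then the integration $\int[E]\in\widehat{\mathrm{Rep}}^\infty(\Pi_\infty(TS^2))$ is not quasi-isomorphic to any element of $\pi^*\widehat{\mathrm{Rep}}^\infty(G)$.
   Context: **Simplices.** $I=[0,1]$, $\Delta_k=\{1\ge t_1\ge\dots\ge t_k\ge 0\}$, oriented by $dt_1\cdots dt_k$, with vertices $v_i=(1,\dots,1,0,\dots,0)$ ($i$ ones); the cofaces insert $1$ at the beginning, repeat a coordinate, or append $0$; the codegeneracies omit a coordinate. $\Pi_\infty(TS^2)=\mathrm{Sing}(S^2)$ is the simplicial set of smooth simplices $\sigma:\Delta_k\to S^2$. **Representations up to homotopy of a simplicial set $X_\bullet$.** For a $k$-simplex $\sigma$ let $Q_j\sigma$ (resp. $P_j\sigma$) be the face on the first (resp. last) $j+1$ vertices, and $(F\cup F')(\sigma)=F(Q_i\sigma)F'(P_j\sigma)$ for cochains of degrees $i,j$. A representation up to homotopy is a graded vector space $E_x$ for each $x\in X_0$ and cochains $F_k(\sigma)\in\mathrm{Hom}^{1-k}(E_{v_k(\sigma)},E_{v_0(\sigma)})$, $\sigma\in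 X_k$, $k\ge0$, with $\sum_{j=1}^{k-1}(-1)^jF_{k-1}(d_j\sigma)+\sum_{j=0}^k(-1)^{j+1}(F_j\cup F_{k-j})(\sigma)=0$; in particular each $(E_x,F_0)$ is a cochain complex. It is unital if $F_1(s_0x)=\mathrm{id}$ and $F_k(s_i\sigma)=0$ for $k>1$. A degree $n$ morphism $\phi:E\to E'$ is a sum of $k$-cochains $\phi_k(\sigma)\in\mathrm{Hom}^{n-k}(E_{v_k(\sigma)},E'_{v_0(\sigma)})$, with differential $D(\phi)_k(\sigma)=\sum_{i+j=k}(-1)^{jn}(F'_j\cup\phi_i)(\sigma)+\sum_{i+j=k}(-1)^{n+j+1}(\phi_j\cup F_i)(\sigma)+\sum_{j=1}^{k-1}(-1)^{j+n}\phi_{k-1}(d_j\sigma)$ and composition $(\phi'\circ\phi)_k=\sum_{i+j=k}(-1)^{jn}\phi'_j\cup\phi_i$. In the dg-category $\widehat{\mathrm{Rep}}^\infty(X_\bullet)$ objects are unital and morphisms satisfy $\phi_k(s_i\sigma)=0$. A quasi-isomorphism is a closed degree $0$ morphism $\phi$ such that $\phi_0(x):(E_x,F_0)\to(E'_x,F'_0)$ induces an isomorphism in cohomology for every $x\in X_0$; two objects are quasi-isomorphic if they are connected by (a zig-zag of) quasi-isomorphisms. **Lie groupoid $G$ and $\pi$.** The nerve $\mathsf{N}G$ has $k$-simplices the sequences $(g_1,\dots,g_k)$ with target of $g_i$ equal to source of $g_{i-1}$; for the pair groupoid this is the set of $(y_0,\dots,y_k)\in(S^2)^{k+1}$. $\widehat{\mathrm{Rep}}^\infty(G)\subset\widehat{\mathrm{Rep}}^\infty(\mathsf{N}G)$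 consists of those unital representations up to homotopy whose spaces $E_x$ are the fibres of a graded vector bundle over $S^2$ and whose $F_k$ are smooth. The simplicial map $\pi:\Pi_\infty(TS^2)\to\mathsf{N}G$ sends $\sigma:\Delta_k\to S^2$ to its vertices $(\sigma(v_0),\dots,\sigma(v_k))$, i.e. to the sequence of arrows given by its edges $v_i\to v_{i-1}$; $\pi^*$ is pullback along $\pi$. **Integration $\int[E]$.** A representation up to homotopy of a Lie algebroid $A$ is a graded vector bundle $E$ with a degree one operator $D$ on $\Omega(A,E)=\Gamma(E\otimes\wedge A^* )$, $D^2=0$, $D(\omega\xi)=(d\omega)\xi+(-1)^{|\omega|}\omega D\xi$. On a trivial bundle with fibre $V$, $D=d+\omega\wedge$ with $\omega\in\mathrm{End}V\otimes\Omega(A)$. Write $(\mathsf{s}V)^k=V^{k+1}$, $[a]=|a|-1$. Let $\pi_k:I^k\to\Delta_k$, $\pi_k(x)=(t_1,\dots,t_k)$, $t_i=\max\{x_i,\dots,x_k\}$; for $x\in I^{k-1}$ let $\lambda_{(k)}(x):I\to I^k$ be the path, linear between the times $\frac{k-j}{k}$, with $\lambda_{(k)}(x)(\frac{k-j}{k})=x_1e_1+\dots+x_je_j$ ($0\le j\le k$, $x_k:=1$); $\Theta_k(t,x)=\pi_k(\lambda_{(k)}(x)(t))$, $\Theta_k^{(n)}(t_1,\dots,t_n,x)=(\Theta_k(t_1,x),\dots,\Theta_k(t_n,x))$ on $\Delta_n\times I^{k-1}$. For forms on a manifold with corners $N$ and smooth $\sigma:\Delta_k\to N$ put $\psi_1(\mathsf{s}a)(\sigma)=(-1)^k\int_{\Delta_k}\sigma^*a$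 and, for $n\ge2$, $\psi_n(\mathsf{s}a_1\otimes\cdots\otimes\mathsf{s}a_n)(\sigma)=(-1)^{\sum_i[a_i](n-i)}\int_{\Delta_n\times I^{k-1}}(\Theta_k^{(n)})^*(p_1^*\sigma^*a_1\wedge\cdots\wedge p_n^*\sigma^*a_n)$ for $k\ge1$, $0$ for $k=0$ (integrals of forms not of top degree are $0$). Set $\overline\psi_n(\mathsf{s}a_1\otimes\cdots\otimes\mathsf{s}a_n)=(-1)^{\frac{k(k-1)}2+k+n-1}\psi_n(\mathsf{s}a_1\otimes\cdots\otimes\mathsf{s}a_n)$, $k=[a_1]+\dots+[a_n]+1$. Identifying $\mathsf{s}(e\otimes a)$ with $(-1)^{|e|}e\otimes\mathsf{s}a$, set $\overline\psi^V_n((e_1\otimes\mathsf{s}a_1)\otimes\cdots\otimes(e_n\otimes\mathsf{s}a_n))=(-1)^{\sum_i[a_i](|e_{i+1}|+\dots+|e_n|)}e_1\cdots e_n\otimes\overline\psi_n(\mathsf{s}a_1\otimes\cdots\otimes\mathsf{s}a_n)$ and $\overline\psi^V(\omega)=\mathsf{s}^{-1}\sum_{n\ge1}\overline\psi^V_n((\mathsf{s}\omega)^{\otimes n})$. For a simplex $\sigma$ choose a trivialization $h:\sigma^*E\cong\Delta_k\times V$ with associated $\omega$; $\mathsf{Hol}(\sigma,E)=h_{v_0}^{-1}\circ\langle\mathbf 1+\overline\psi^V(\omega),[\Delta_k]\rangle\circ h_{v_k}$, with $[\Delta_k]=\mathrm{id}_{\Delta_k}$ and $\mathbf 1$ the cochain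 equal to $\mathrm{id}$ on 1-simplices and $0$ on others (independent of $h$). Then $\int[E]$ is the unital representation up to homotopy $x\mapsto E_x$, $F_k(\sigma)=\mathsf{Hol}(\sigma,E)$. *)

(* Defs.v *)
From HB Require Import structures.
From mathcomp Require Import all_boot all_order all_algebra perm ring.
From mathcomp Require Import all_classical all_reals all_analysis.

Set Implicit Arguments.
Unset Strict Implicit.
Unset Printing Implicit Defensive.
Import Order.TTheory GRing.Theory Num.Theory.
Import numFieldNormedType.Exports.
Local Open Scope classical_set_scope.
Local Open Scope ring_scope.

Record omap (m n : nat) := OMap {
  omapf :> 'I_m.+1 -> 'I_n.+1 ;
  omap_homo : {homo omapf : i j / (i <= j)%N} }.

Lemma omap_eq m n (f g : omap m n) : f =1 g -> f = g.
Proof.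
case: f g => [f Hf] [g Hg] /= /funext E; move: Hf Hg; rewrite E => Hf Hg.
by rewrite (Prop_irrelevance Hf Hg).
Qed.

Definition omap_id n : omap n n := @OMap n n id (fun _ _ => id).

Definition omap_comp m n p (f : omap m n) (g : omap n p) : omap m p :=
  @OMap m p (g \o f) (fun i j ij => omap_homo g (omap_homo f ij)).

(* The map [m] -> [n] induced by a nondecreasing f : nat -> nat; the values of
   f exceeding n are cut off to n, which never happens in the uses below when
   the indices are in their natural range. *)
Lemma clip_homo m n (f : nat -> nat) : {homo f : i j / (i <= j)%N} ->
  {homo (fun i : 'I_m.+1 => inord (minn (f i) n) : 'I_n.+1)
    : i j / (i <= j)%N}.
Proof.
move=> Hf i j ij; rewrite !inordK ?ltnS ?geq_minr //.
by rewrite leq_min geq_minr andbT (leq_trans (geq_minl _ _)) ?Hf.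
Qed.

Definition clip m n f (Hf : {homo f : i j / (i <= j)%N}) : omap m n :=
  OMap (@clip_homo m n f Hf).

Lemma cst_homo i : {homo (fun=> i) : j l / (j <= l)%N}.
Proof. by []. Qed.
Lemma id_homo : {homo (fun i => i) : j l / (j <= l)%N}.
Proof. by []. Qed.
Lemma add_homo n : {homo (fun i => n + i)%N : j l / (j <= l)%N}.
Proof. by move=> j l; rewrite leq_add2l. Qed.
Lemma bump_homo n : {homo bump n : j l / (j <= l)%N}.
Proof. by move=> j l; rewrite leq_bump2. Qed.
Lemma unbump_homo n : {homo unbump n : j l / (j <= l)%N}.
Proof.
move=> j l jl; rewrite /unbump.
have [nj|jn] := ltnP n j; first by rewrite (leq_trans nj jl) leq_sub2r.
rewrite subn0; have [nl|_] := ltnP n l; last by rewrite subn0.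
by rewrite -ltnS subn1 prednK ?(leq_ltn_trans _ nl)//; apply: (leq_ltn_trans jn).
Qed.

Record sset := SSet {
  simp :> nat -> Type ;
  act : forall m n, omap m n -> simp n -> simp m ;
  act_id : forall n (s : simp n), act (omap_id n) s = s ;
  act_comp : forall m n p (f : omap m n) (g : omap n p) (s : simp p),
    act (omap_comp f g) s = act f (act g s) }.
Arguments act {_ _ _}.

Section faces.
Variables (X : sset) (k : nat).
Implicit Type s : X k.

(* v_i(s), as an element of X_0 *)
Definition vtx i s : X 0%N := act (clip 0 k (cst_homo i)) s.
(* Q_j(s) *)
Definition front j s : X j := act (clip j k id_homo) s.
(* P_j(s) *)
Definition back j s : X j := act (clip j k (add_homo (k - j))) s.
(* d_j(s), for k > 0 *)
Definition face j s : X k.-1 := act (clip k.-1 k (bump_homo j)) s.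
(* s_i(s) *)
Definition degen i s : X k.+1 := act (clip k.+1 k (unbump_homo i)) s.
End faces.

Record smap (X Y : sset) := SMap {
  smapf :> forall n, X n -> Y n ;
  smap_nat : forall m n (f : omap m n) (s : X n),
    smapf (act f s) = act f (smapf s) }.

Section ruth.
Variables (R : realType) (X : sset).

Definition gspaces := X 0%N -> int -> lmodType R.

(* A cochain of total degree n sends a k-simplex s to a linear map of degree
   n - k from E_{v_k(s)} to E'_{v_0(s)}.  To avoid transports along equalities
   between points and between degrees, the endpoints x, y and the source and
   target degrees d, d' are arguments; only the values at x = v_k(s),
   y = v_0(s), d' = d + n - k are meaningful, the others are never used. *)
Definition cochain (E E' : gspaces) :=
  forall k (s : X k) (x y : X 0%N) (d d' : int), {linear E x d -> E' y d'}.

(* (G_j \cup F_{k-j})(s) e for e of degree d, where F has total degree n *)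
Definition cup (E E' E'' : gspaces) (G : cochain E' E'') (F : cochain E E')
    (n : int) (j k : nat) (s : X k) (x y : X 0%N) (d d' : int) (e : E x d) :
    E'' y d' :=
  let v := vtx j s in
  let m := d + n - (k - j)%:Z in
  G j (front j s) v y m d' (F (k - j)%N (back (k - j) s) x v d m e).

(* The data of a representation up to homotopy: its graded spaces and its
   cochain F, of total degree 1.  The axioms are unital_ruth below. *)
Record preruth := PreRuth {
  fib : gspaces ;
  op : cochain fib fib }.

Definition is_ruth (E : preruth) : Prop :=
  forall k (s : X k) (d : int) (e : fib E (vtx k s) d),
  let x := vtx k s in let y := vtx 0 s in let d' : int := d + 2 - k%:Z in
    \sum_(1 <= j < k) (-1) ^+ j *: op E (face j s) x y d d' e
  + \sum_(j < k.+1) (-1) ^+ j.+1 *: cup (op E) (op E) 1 j s y d' e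
  = 0 :> fib E y d'.

Definition is_unital (E : preruth) : Prop :=
  (forall (x : X 0%N) d (e : fib E x d), op E (degen 0 x) x x d d e = e) /\
  (forall k (s : X k.+1) i, (i <= k.+1)%N ->
   let s' := degen i s in forall d (e : fib E (vtx k.+2 s') d),
   op E s' (vtx k.+2 s') (vtx 0 s') d (d + 1 - k.+2%:Z) e = 0).

Definition unital_ruth (E : preruth) : Prop := is_ruth E /\ is_unital E.

(* D(phi)_k(s) e, where phi has degree n *)
Definition mor_diff (E E' : preruth) (n : int)
    (phi : cochain (fib E) (fib E')) k (s : X k) (d : int)
    (e : fib E (vtx k s) d) : fib E' (vtx 0 s) (d + n + 1 - k%:Z) :=
  let x := vtx k s in let y := vtx 0 s in let d' : int := d + n + 1 - k%:Z in
    \sum_(j < k.+1) ((-1) ^ (j%:Z * n)) *: cup (op E') phi n j s y d' e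
  + \sum_(j < k.+1) ((-1) ^ (n + j%:Z + 1)) *: cup phi (op E) 1 j s y d' e
  + \sum_(1 <= j < k) ((-1) ^ (j%:Z + n)) *: phi k.-1 (face j s) x y d d' e.

Definition closed_mor (E E' : preruth) (n : int)
    (phi : cochain (fib E) (fib E')) : Prop :=
  forall k (s : X k) d (e : fib E (vtx k s) d), mor_diff n phi e = 0.

Definition normalized_mor (E E' : preruth) (n : int)
    (phi : cochain (fib E) (fib E')) : Prop :=
  forall k (s : X k) i, (i <= k)%N ->
  let s' := degen i s in forall d (e : fib E (vtx k.+1 s') d),
  phi k.+1 s' (vtx k.+1 s') (vtx 0 s') d (d + n - k.+1%:Z) e = 0.

Definition cocycle (E : preruth) (x : X 0%N) d (z : fib E x d) : Prop :=
  op E x x x d (d + 1) z = 0.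

Definition coboundary (E : preruth) (x : X 0%N) d (z : fib E x d) : Prop :=
  exists b : fib E x (d - 1), z = op E x x x (d - 1) d b.

Definition iso_in_cohomology (E E' : preruth)
    (phi : cochain (fib E) (fib E')) : Prop :=
  forall (x : X 0%N) (d : int),
  (forall z : fib E x d, cocycle z ->
     coboundary (phi 0%N x x x d d z) -> coboundary z) /\
  (forall z' : fib E' x d, cocycle z' ->
     exists2 z : fib E x d, cocycle z & coboundary (z' - phi 0%N x x x d d z)).

Definition quasi_iso (E E' : preruth) (phi : cochain (fib E) (fib E')) : Prop :=
  [/\ closed_mor 0 phi, normalized_mor 0 phi & iso_in_cohomology phi].

(* Zig-zags of quasi-isomorphisms all of whose objects, except possibly the
   first one, are required to be unital representations up to homotopy; for a
   first object which is one too, this is quasi-isomorphism in the dg-category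
   of unital representations up to homotopy. *)
Inductive quasi_isomorphic : preruth -> preruth -> Prop :=
| qi_refl E : quasi_isomorphic E E
| qi_forth E E' E'' (phi : cochain (fib E) (fib E')) :
    quasi_iso phi -> unital_ruth E' ->
    quasi_isomorphic E' E'' -> quasi_isomorphic E E''
| qi_back E E' E'' (phi : cochain (fib E') (fib E)) :
    quasi_iso phi -> unital_ruth E' ->
    quasi_isomorphic E' E'' -> quasi_isomorphic E E''.

End ruth.

Definition pullback (R : realType) (X Y : sset) (f : smap X Y)
    (E : preruth R Y) : preruth R X :=
  @PreRuth R X (fun x => fib E (f 0%N x))
    (fun k s x y => op E (f k s) (f 0%N x) (f 0%N y)).

Section smooth.
Variables (R : realType) (V W : normedModType R).

Fixpoint is_Cn n (U : set V) (f : V -> W) : Prop :=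
  if n is m.+1 then
    (forall x, U x -> differentiable f x) /\ (forall v, is_Cn m U ('D_v f))
  else forall x, U x -> {for x, continuous f}.

(* Only used for finite-dimensional V and W. *)
Definition is_Cinf (U : set V) (f : V -> W) : Prop := forall n, is_Cn n U f.

(* T is viewed as a subset of V through i; g is a smooth extension of
   f : T -> W, restricted to P, around the point i a. *)
Definition smooth_ext (T : Type) (i : T -> V) (P : set T) (f : T -> W) (a : T)
    (g : V -> W) : Prop :=
  exists U : set V, [/\ open U, U (i a), is_Cinf U g &
    forall b, P b -> U (i b) -> f b = g (i b)].

Definition smooth_on (T : Type) (i : T -> V) (P : set T) (f : T -> W) : Prop :=
  forall a, P a -> exists g, smooth_ext i P f a g.

(* The derivative of f : A -> W at a, in the direction v, computed with any
   smooth extension; for A the closure of its interior, as for simplices, it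
   does not depend on the extension. *)
Definition tderiv (A : set V) (f : A -> W) (a : A) (v : V) : W :=
  'D_v (get (smooth_ext (fun b : A => val b) setT f a)) (val a).

End smooth.

Section forms.
Variable R : realType.

(* Points in T, tangent vectors in V. *)
Definition form (T V : Type) (p : nat) := T -> ('I_p -> V) -> R.
Definition hform (T V : Type) := {p : nat & form T V p}.

Definition wedge T V p q (a : form T V p) (b : form T V q) : form T V (p + q) :=
  fun x v => (p`! * q`!)%:R^-1 *
    \sum_(s : 'S_(p + q)) (-1) ^+ s *
      (a x (fun i => v (s (lshift q i))) * b x (fun j => v (s (rshift p j)))).

Fixpoint wedges T V (s : seq (hform T V)) : hform T V :=
  if s is a :: s' then
    Tagged (form T V) (wedge (tagged a) (tagged (wedges s')))
  else Tagged (form T V) ((fun _ _ => 1) : form T V 0).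

Definition pull (V W : normedModType R) (f : V -> W) p (a : form W W p) :
    form V V p :=
  fun x v => a (f x) (fun i => 'D_(v i) f x).

Definition hpull (V W : normedModType R) (f : V -> W) (a : hform W W) :
    hform V V := Tagged (form V V) (pull f (tagged a)).

(* Only applied to bounded measurable functions with bounded support, for which
   the iterated integral is the Lebesgue integral over R^m. *)
Fixpoint iterint m : ('rV[R]_m -> R) -> R :=
  if m is m'.+1 then fun f : 'rV[R]_(1 + m') -> R =>
    \int[lebesgue_measure]_(x in [set: R])
      iterint (fun y : 'rV[R]_m' => f (row_mx x%:M y))
  else fun f => f 0.

Definition stdvec m (i : nat) : 'rV[R]_m := \row_(j < m) (j == i :> nat)%:R.

Definition int_form m (A : set 'rV[R]_m) (w : hform 'rV[R]_m 'rV[R]_m) : R :=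
  if tag w == m then
    iterint (fun x => \1_A x * tagged w x (fun i => stdvec m i))
  else 0.

End forms.

Section sphere.
Variable R : realType.

Definition Delta k : set 'rV[R]_k :=
  [set t | (forall i, 0 <= t 0 i <= 1) /\
           (forall i j : 'I_k, (i <= j)%N -> t 0 j <= t 0 i)].

Definition cube k : set 'rV[R]_k := [set x | forall i, 0 <= x 0 i <= 1].

Arguments Delta : clear implicits.
Arguments cube : clear implicits.

Definition dot n (u v : 'rV[R]_n) : R := \sum_i u 0 i * v 0 i.

Definition S2 : set 'rV[R]_3 := [set x | dot x x = 1].

Definition tangent (x : S2) (v : 'rV[R]_3) : Prop := dot (val x) v = 0.

(* Only the values on tangent vectors are meaningful. *)
Definition S2form p := form R S2 'rV[R]_3 p.
Definition S2hform := hform R S2 'rV[R]_3.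

Definition alternating_at p (a : S2form p) (x : S2) : Prop :=
  (forall (v : 'I_p -> 'rV[R]_3) i (c : R) (u w : 'rV[R]_3),
     (forall j, tangent x (v j)) -> tangent x u -> tangent x w ->
     a x [eta v with i |-> c *: u + w] =
     c * a x [eta v with i |-> u] + a x [eta v with i |-> w]) /\
  (forall (v : 'I_p -> 'rV[R]_3) i j, (forall l, tangent x (v l)) ->
     i != j -> v i = v j -> a x v = 0).

Definition smooth_field (Z : S2 -> 'rV[R]_3) : Prop :=
  smooth_on (fun x : S2 => val x) setT Z /\ forall x, tangent x (Z x).

Definition smooth_form p (a : S2form p) : Prop :=
  (forall x, alternating_at a x) /\
  (forall Z : 'I_p -> S2 -> 'rV[R]_3, (forall i, smooth_field (Z i)) ->
   smooth_on (fun x : S2 => val x) setT (fun x => a x (fun i => Z i x) : R^o)).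

Definition volume_form (eta : S2form 2) : Prop :=
  smooth_form eta /\
  forall x, exists2 v : 'I_2 -> 'rV[R]_3,
    (forall i, tangent x (v i)) & eta x v != 0.

(* v_i = (1,...,1,0,...,0), with i ones *)
Definition vert n (i : nat) : 'rV[R]_n := \row_(l < n) (l < i)%:R.

(* t_i, with t_0 = 1 and t_i = 0 for i > m *)
Definition tcoord m (t : 'rV[R]_m) (i : nat) : R :=
  if i is j.+1 then oapp (t 0) 0 (insub j) else 1.

(* barycentric coordinates: t = \sum_i (t_i - t_{i+1}) v_i *)
Definition bary m (t : 'rV[R]_m) (i : nat) : R := tcoord t i - tcoord t i.+1.

(* the affine map with v_i |-> v_{f i}; on cofaces and codegeneracies it is
   the insertion of 1, the repetition of a coordinate, the insertion of 0, and
   the omission of a coordinate *)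
Definition aff m n (f : 'I_m.+1 -> 'I_n.+1) (t : 'rV[R]_m) : 'rV[R]_n :=
  \sum_(i < m.+1) bary t i *: vert n (f i).


Lemma tcoord_ge0 m (t : 'rV[R]_m) i : Delta m t -> 0 <= tcoord t i.
Proof.
case=> H _; case: i => [|i] //=; rewrite ?ler01//.
by case: insub => [j|] //=; case/andP: (H j).
Qed.

Lemma bary_ge0 m (t : 'rV[R]_m) i : Delta m t -> 0 <= bary t i.
Proof.
move=> Ht; rewrite /bary subr_ge0; case: (Ht) => H1 H2.
rewrite {1}/tcoord; case: insubP => [j jm ij|_] /=; last exact: tcoord_ge0.
case: i jm ij => [|i] jm ij; first by case/andP: (H1 j).
have im : (i < m)%N by apply: ltn_trans jm.
by rewrite /= (insubT (fun x => x < m)%N im) /=; apply: H2; rewrite /= ij.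
Qed.

Lemma bary_sum_from m (t : 'rV[R]_m) l : (l <= m.+1)%N ->
  \sum_(i < m.+1 | (l <= i)%N) bary t i = tcoord t l.
Proof.
move=> lm; have <- : \sum_(l <= i < m.+1) bary t i =
   \sum_(i < m.+1 | (l <= i)%N) bary t i.
  by rewrite big_geq_mkord.
have -> : \sum_(l <= i < m.+1) bary t i =
    - \sum_(l <= i < m.+1) (tcoord t i.+1 - tcoord t i).
  by rewrite -sumrN; apply: eq_bigr => i _; rewrite opprB.
rewrite telescope_sumr// opprB -[RHS]subr0; congr (_ - _).
by rewrite /= insubF ?ltnn.
Qed.

Lemma tcoord_sum m n (t : 'rV[R]_m) (f : 'I_m.+1 -> 'I_n.+1) l :
  tcoord (aff f t) l = \sum_(i < m.+1) bary t i * (l <= f i)%N%:R.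
Proof.
case: l => [|l] /=.
  transitivity (\sum_(i < m.+1 | (0 <= i)%N) bary t i).
    by rewrite bary_sum_from.
  by apply: eq_big => // i _; rewrite mulr1.
case: insubP => [j jn <-|] /=.
  by rewrite /aff summxE; apply: eq_bigr => i _; rewrite !mxE.
rewrite -leqNgt => nl; rewrite big1// => i _.
by rewrite leqNgt (leq_trans (ltn_ord _))// mulr0.
Qed.

Lemma bary_aff m n (t : 'rV[R]_m) (f : 'I_m.+1 -> 'I_n.+1) l :
  bary (aff f t) l = \sum_(i < m.+1) bary t i * (f i == l :> nat)%:R.
Proof.
rewrite /bary !tcoord_sum -sumrB; apply: eq_bigr => i _; rewrite -mulrBr.
congr (_ * _); case: (ltngtP (f i) l) => // H; rewrite ?subrr// ?subr0//.
Qed.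

Lemma aff_id m (t : 'rV[R]_m) : aff id t = t.
Proof.
apply/rowP => j; rewrite /aff summxE.
transitivity (\sum_(i < m.+1 | (j < i)%N) bary t i).
  rewrite [RHS]big_mkcond; apply: eq_bigr => i _; rewrite !mxE.
  by case: ltnP => _; rewrite ?mulr1 ?mulr0.
rewrite bary_sum_from ?ltnS 1?ltnW//= insubT//= => jm.
by congr (t 0 _); apply/val_inj.
Qed.

Lemma aff_comp m n p (f : 'I_m.+1 -> 'I_n.+1) (g : 'I_n.+1 -> 'I_p.+1)
  (t : 'rV[R]_m) : aff (g \o f) t = aff g (aff f t).
Proof.
rewrite {2}/aff; under eq_bigr do rewrite bary_aff scaler_suml.
rewrite exchange_big /=; apply: eq_bigr => i _.
rewrite (bigD1 (f i)) //= eqxx mulr1 big1 ?addr0// => j jf.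
by rewrite -val_eqE eq_sym in jf; rewrite (negbTE jf) mulr0 scale0r.
Qed.

Lemma aff_Delta m n (f : 'I_m.+1 -> 'I_n.+1) (t : 'rV[R]_m) :
  Delta m t -> Delta n (aff f t).
Proof.
move=> Ht; have E (j : 'I_n) : aff f t 0 j = tcoord (aff f t) j.+1.
  by rewrite /= insubT//= => jm; congr (aff f t 0 _); apply/val_inj.
have S1 : \sum_(i < m.+1) bary t i = 1.
  by have := @bary_sum_from m t 0 isT.
split=> [j|i j ij]; rewrite !E !tcoord_sum.
  apply/andP; split.
    by apply: sumr_ge0 => i _; rewrite mulr_ge0 ?bary_ge0.
  rewrite -[leRHS]S1; apply: ler_sum => i _.
  by apply: ler_piMr; [exact: bary_ge0|rewrite lern1 leq_b1].
apply: ler_sum => l _; rewrite ler_wpM2l ?bary_ge0// ler_nat.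
by case: (ltnP j) => //= jf; rewrite (leq_ltn_trans ij jf).
Qed.

Lemma differentiable_bary m i (t : 'rV[R]_m) :
  differentiable (fun u : 'rV[R]_m => bary u i : R^o) t.
Proof.
have H j : differentiable (fun u : 'rV[R]_m => tcoord u j : R^o) t.
  case: j => [|j] /=; first exact: differentiable_cst.
  case: insub => [l|] /=; last exact: differentiable_cst.
  exact: differentiable_coord.
exact: differentiableB.
Qed.

Lemma differentiable_aff m n (f : 'I_m.+1 -> 'I_n.+1) (t : 'rV[R]_m) :
  differentiable (aff f : 'rV[R]_m -> 'rV[R]_n) t.
Proof.
have -> : aff f = \sum_(i < m.+1) (fun u => bary u i *: vert n (f i)).
  by apply/funext => u; rewrite fct_sumE.
apply: differentiable_sum => i.
exact/differentiableZl/differentiable_bary.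
Qed.

Lemma bary_line m i (h : R) (v t : 'rV[R]_m) :
  bary (h *: v + t) i = h * (bary v i - bary (0 : 'rV[R]_m) i) + bary t i.
Proof.
have E j : tcoord (h *: v + t) j = h * (tcoord v j - tcoord (0 : 'rV[R]_m) j) + tcoord t j.
  case: j => [|j] /=; first by rewrite subrr mulr0 add0r.
  by case: insub => [l|] /=; rewrite ?mxE ?subr0 ?mulr0 ?addr0.
by rewrite /bary !E; ring.
Qed.

Lemma aff_line m n (f : 'I_m.+1 -> 'I_n.+1) (h : R) (v t : 'rV[R]_m) :
  aff f (h *: v + t) = h *: (aff f v - aff f 0) + aff f t.
Proof.
rewrite /aff -sumrB scaler_sumr -big_split; apply: eq_bigr => i _ /=.
by rewrite bary_line -scalerBl scalerA -scalerDl.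
Qed.

Lemma derive_comp_aff m n (f : 'I_m.+1 -> 'I_n.+1) (W : normedModType R)
  (g : 'rV[R]_n -> W) v :
  'D_v (g \o aff f) = 'D_(aff f v - aff f 0) g \o aff f.
Proof.
apply/funext => t; rewrite /derive [in RHS]/=.
have -> // : (fun h => h^-1 *: ((g \o aff f \o shift t) (h *: v) - (g \o aff f) t)) =
  (fun h => h^-1 *: ((g \o shift (aff f t)) (h *: (aff f v - aff f 0))
    - g (aff f t))).
by apply/funext => h; rewrite /= aff_line.
Qed.

Lemma is_Cn_comp_aff N m n (f : 'I_m.+1 -> 'I_n.+1) (W : normedModType R)
  (g : 'rV[R]_n -> W) (U : set 'rV[R]_n) :
  is_Cn N U g -> is_Cn N (aff f @^-1` U) (g \o aff f).
Proof.
elim: N g => [|N IH] g /=.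
  move=> H x Ux; apply: continuous_comp; last exact: H.
  exact/differentiable_continuous/differentiable_aff.
case=> H1 H2; split=> [x Ux|v].
  apply: differentiable_comp; [exact: differentiable_aff|exact: H1].
by rewrite derive_comp_aff; apply: IH.
Qed.

Definition smooth_simplex k :=
  {s : Delta k -> S2 |
    smooth_on (fun t : Delta k => val t) setT (fun t => val (s t))}.

Definition aff_simp m n (f : omap m n) (t : Delta m) : Delta n :=
  exist _ (aff f (val t)) (mem_set (aff_Delta f (set_mem (valP t)))).

Lemma smooth_act m n (f : omap m n) (s : smooth_simplex n) :
  smooth_on (fun t : Delta m => val t) setT (fun t => val (sval s (aff_simp f t))).
Proof.
case: s => s Hs t _ /=; have [g [U [oU Ut HU Hg]]] := Hs (aff_simp f t) I.
exists (g \o aff f), (aff f @^-1` U); split => //=.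
- apply: open_comp => // x _.
  exact/differentiable_continuous/differentiable_aff.
- by move=> N; apply: is_Cn_comp_aff.
- by move=> b _ Ub; rewrite Hg.
Qed.

Definition sing_act m n (f : omap m n) (s : smooth_simplex n) :
    smooth_simplex m :=
  exist _ (fun t => sval s (aff_simp f t)) (smooth_act f s).

Lemma smooth_simplex_eq k (s s' : smooth_simplex k) :
  sval s =1 sval s' -> s = s'.
Proof.
case: s s' => [s Hs] [s' Hs'] /= /funext E; move: Hs Hs'; rewrite E => Hs Hs'.
by rewrite (Prop_irrelevance Hs Hs').
Qed.

Lemma sing_act_id n (s : smooth_simplex n) : sing_act (omap_id n) s = s.
Proof.
apply: smooth_simplex_eq => t /=; congr (sval s _).
by apply: val_inj => /=; rewrite aff_id.
Qed.

Lemma sing_act_comp m n p (f : omap m n) (g : omap n p) (s : smooth_simplex p) :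
  sing_act (omap_comp f g) s = sing_act f (sing_act g s).
Proof.
apply: smooth_simplex_eq => t /=; congr (sval s _).
by apply: val_inj => /=; rewrite aff_comp.
Qed.

Definition Sing : sset := SSet sing_act_id sing_act_comp.

Definition nerve_act m n (f : omap m n) (y : 'I_n.+1 -> S2) : 'I_m.+1 -> S2 :=
  y \o f.

Definition nerve : sset :=
  @SSet (fun k => 'I_k.+1 -> S2) nerve_act
    (fun _ _ => erefl) (fun _ _ _ _ _ _ => erefl).

Lemma vert_Delta k i : Delta k (vert k i).
Proof.
split=> [j|j l jl]; rewrite !mxE ?ler0n ?lern1 ?leq_b1 ?ler_nat//.
by case: (ltnP l i) => // li; rewrite (leq_ltn_trans jl li).
Qed.

Definition vert_simp k (i : 'I_k.+1) : Delta k :=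
  exist _ (vert k i) (mem_set (vert_Delta k i)).

Definition vertices k (s : Sing k) : nerve k :=
  fun i => sval s (vert_simp i).

Lemma aff_vert m n (f : 'I_m.+1 -> 'I_n.+1) (i : 'I_m.+1) :
  aff f (vert m i) = vert n (f i).
Proof.
have E (j : nat) : tcoord (vert m i) j = (j <= i)%N%:R.
  case: j => [|j] //=; case: insubP => [l _ <-|] /=; first by rewrite mxE.
  by rewrite -leqNgt => mj; rewrite ltnNge (leq_trans _ mj)// -ltnS.
rewrite /aff (bigD1 i)//= big1 => [|j ji]; rewrite /bary !E.
  by rewrite leqnn ltnn subr0 scale1r addr0.
case: (ltngtP j i) => H; rewrite ?subrr ?scale0r//.
by move: ji; rewrite -val_eqE /= H eqxx.
Qed.

Lemma vertices_nat m n (f : omap m n) (s : Sing n) :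
  vertices (act f s) = act f (vertices s).
Proof.
apply/funext => i; rewrite /vertices /=; congr (sval s _).
by apply: val_inj => /=; rewrite aff_vert.
Qed.

Definition pi_map : smap Sing nerve := SMap vertices_nat.

(* lambda_(k)(x) at time t: the l-th coordinate (l = 0, ..., k-1) is constant
   equal to x_l up to the time (k-l-1)/k, then decreases linearly to 0, which
   it reaches at the time (k-l)/k. *)
Definition lambda k (x : 'rV[R]_k.-1) (t : R) : 'rV[R]_k :=
  \row_(l < k) (oapp (x 0) 1 (insub (l : nat)) *
    Num.max 0 (Num.min 1 ((k - l)%:R - k%:R * t))).

Definition cube_to_simplex k (x : 'rV[R]_k) : 'rV[R]_k :=
  \row_(i < k) \big[Num.max/0]_(l < k | (i <= l)%N) x 0 l.

Definition Theta k (t : R) (x : 'rV[R]_k.-1) : 'rV[R]_k :=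
  cube_to_simplex (lambda x t).

(* A point of (Delta_k)^n is the matrix of its rows p_1, ..., p_n. *)
Definition Theta_n n k (z : 'rV[R]_(n + k.-1)) : 'M[R]_(n, k) :=
  \matrix_(i < n, j < k) Theta (lsubmx z 0 i) (rsubmx z) 0 j.

Definition simplex_cube n k : set 'rV[R]_(n + k.-1) :=
  [set z | Delta n (lsubmx z) /\ cube k.-1 (rsubmx z)].

Definition Chen_form n k (a : 'I_n -> hform R 'rV[R]_k 'rV[R]_k) :
    hform R 'rV[R]_(n + k.-1) 'rV[R]_(n + k.-1) :=
  hpull (@Theta_n n k : 'rV[R]_(n + k.-1) -> 'M[R]_(n, k))
    (wedges [seq hpull (fun z : 'M[R]_(n, k) => row i z) (a i) | i <- enum 'I_n]).

(* [a] = |a| - 1 *)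
Definition sdeg T V (a : hform R T V) : int := (tag a)%:Z - 1.

(* psi_n(s a_1 (x) ... (x) s a_n), for forms a_1, ..., a_n on Delta_k, evaluated
   at the simplex id : Delta_k -> Delta_k *)
Definition psi k n (a : 'I_n -> hform R 'rV[R]_k 'rV[R]_k) : R :=
  match n return ('I_n -> hform R 'rV[R]_k 'rV[R]_k) -> R with
  | 0 => fun=> 0
  | 1 => fun a => (-1) ^+ k * int_form (Delta k) (a ord0)
  | n'.+2 => fun a =>
      if k is 0 then 0 else
      (-1) ^ (\sum_(i < n'.+2) sdeg (a i) * (n'.+2 - i.+1)%:Z) *
      int_form (@simplex_cube n'.+2 k) (Chen_form a)
  end a.

Definition psibar k n (a : 'I_n -> hform R 'rV[R]_k 'rV[R]_k) : R :=
  let m : int := \sum_(i < n) sdeg (a i) + 1 in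
  (-1) ^ (((m * (m - 1)) %/ 2)%Z + m + n%:Z - 1) * psi a.

(* The operator D = d + omega on the trivial graded vector bundle over S^2 whose
   fibre V has a basis (e_i) of homogeneous elements, of degrees bdeg i, with
   omega = \sum_(i, j) E_ij (x) cform i j of total degree 1, E_ij being the
   endomorphism e_j |-> e_i of degree bdeg i - bdeg j.  Such a D is a
   representation up to homotopy of TS^2 when D^2 = 0, but its holonomies make
   sense without this condition. *)
Record superconnection := Superconnection {
  brank : nat ;
  bdeg : 'I_brank -> int ;
  cform : 'I_brank -> 'I_brank -> S2hform ;
  cform_smooth : forall i j, smooth_form (tagged (cform i j)) ;
  cform_deg : forall i j, (tag (cform i j))%:Z + (bdeg i - bdeg j) = 1 \/
    forall x v, tagged (cform i j) x v = 0 }.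

(* s^* a, a form on Delta_k *)
Definition pull_simplex k (s : Sing k) p (a : S2form p) :
    form R 'rV[R]_k 'rV[R]_k p :=
  fun t v => if insub t is Some u then
    a (sval s u)
      (fun i => tderiv (fun w : Delta k => val (sval s w)) u (v i))
  else 0.

Definition hpull_simplex k (s : Sing k) (a : S2hform) :
    hform R 'rV[R]_k 'rV[R]_k :=
  Tagged (form R 'rV[R]_k 'rV[R]_k) (pull_simplex s (tagged a)).

Section holonomy.
Variable E : superconnection.
Local Notation r := (brank E).

(* The contribution of
   (E_c1 (x) a_1) (x) ... (x) (E_cn (x) a_n), a_l = s^* (cform c_l),
   to s^-1 psibar^V_n((s omega)^(x)n)([Delta_k]).  The first sign comes from
   the identification of s(e (x) a) with (-1)^|e| e (x) s a in each factor, the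
   last one from the same identification in s^-1. *)
Definition hol_summand k (s : Sing k) n (c : {ffun 'I_n -> 'I_r * 'I_r}) :
    'M[R]_r :=
  let a l := hpull_simplex s (cform (c l).1 (c l).2) in
  let edeg l := bdeg (c l).1 - bdeg (c l).2 in
  ((-1) ^ (\sum_(l < n) edeg l) *
   (-1) ^ (\sum_(l < n) sdeg (a l) * \sum_(l' < n | (l < l')%N) edeg l') *
   (-1) ^ (\sum_(l < n) edeg l) *
   psibar a)
  *: \big[mulmx/1%:M]_(l < n) delta_mx (c l).1 (c l).2.

(* Hol(s, E) for the global trivialization of the bundle, as a matrix acting on
   column vectors *)
Definition Hol k (s : Sing k) : 'M[R]_r :=
  \matrix_(i, j) ((k == 1%N)%:R * (i == j)%:R +
    \big[+%R/0]_(1 <= n <oo) (\sum_(c : {ffun 'I_n -> 'I_r * 'I_r})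
       hol_summand s c i j)).

Definition vfib (d : int) : lmodType R :=
  {ffun {i : 'I_r | bdeg i == d} -> R^o}.

(* the block V^d -> V^d' of a matrix *)
Definition block (M : 'M[R]_r) (d d' : int) (e : vfib d) : vfib d' :=
  [ffun i => \sum_j M (val i) (val j) * e j].

Lemma block_linear (M : 'M[R]_r) (d d' : int) : linear (@block M d d').
Proof.
move=> c u v; apply/ffunP => i; rewrite !ffunE scaler_sumr -big_split.
apply: eq_bigr => j _ /=; rewrite !ffunE mulrDr; congr (_ + _).
by rewrite /GRing.scale /= mulrCA.
Qed.

HB.instance Definition _ M d d' :=
  GRing.isLinear.Build R (vfib d) (vfib d') _ (@block M d d')
    (@block_linear M d d').

Definition integration : preruth R Sing :=
  @PreRuth R Sing (fun _ => vfib)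
    (fun k s _ _ d d' => @block (Hol s) d d' : {linear vfib d -> vfib d'}).

End holonomy.

Section volume.
Variables (eta : S2form 2) (Heta : smooth_form eta).

Definition vol_cform (i j : 'I_2) : S2hform :=
  if (i == 0) && (j == 1) then Tagged S2form eta
  else Tagged S2form ((fun _ _ => 0) : S2form (1 + j - i)).

Lemma is_Cn_cst n (V W : normedModType R) (U : set V) (w : W) :
  is_Cn n U (cst w : V -> W).
Proof.
elim: n w => [|n IH] w /=; first by move=> x _; exact: cst_continuous.
split=> [x _|v]; first exact: differentiable_cst.
have -> : 'D_v (cst w : V -> W) = cst 0 by apply/funext => x; exact: derive_cst.
exact: IH.
Qed.

Lemma smooth_form0 p : smooth_form ((fun _ _ => 0) : S2form p).
Proof.
split=> [x|Z _ x _]; first by split=> // v i c u w _ _ _; rewrite mulr0 addr0.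
exists (cst 0), setT; split=> //; first exact: openT.
by move=> n; exact: is_Cn_cst.
Qed.

Lemma vol_cform_smooth i j : smooth_form (tagged (vol_cform i j)).
Proof.
by rewrite /vol_cform; case: ifP => _ //=; apply: smooth_form0.
Qed.

Lemma vol_cform_deg i j :
  (tag (vol_cform i j))%:Z + ((i : nat)%:Z - (j : nat)%:Z) = 1 \/
  forall x v, tagged (vol_cform i j) x v = 0.
Proof.
by rewrite /vol_cform; case: ifP => [/andP[/eqP -> /eqP ->]|_]; [left|right].
Qed.

(* E^0 and E^1 are spanned by e_0 and e_1; eta is the component e_1 |-> e_0.
   Here D^2 = 0 since d eta = 0 (there are no 3-forms on S^2) and
   E_01 E_01 = 0. *)
Definition vol_superconnection : superconnection :=
  @Superconnection 2 (fun i => (i : nat)%:Z) vol_cform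
    vol_cform_smooth vol_cform_deg.

End volume.

(* A Z-graded vector bundle over S^2: each component is a smooth vector bundle
   of finite rank, given by its fibres and an atlas of local trivializations. *)
Record gvbundle := GVBundle {
  gfib : S2 -> int -> lmodType R ;
  chart : int -> Type ;
  dom : forall d, chart d -> set S2 ;
  rank : forall d, chart d -> nat ;
  triv : forall d (c : chart d) (x : S2), {linear 'rV[R]_(rank c) -> gfib x d} ;
  dom_open : forall d (c : chart d), exists2 U : set 'rV[R]_3, open U &
    dom c = [set x | U (val x)] ;
  dom_cover : forall d x, exists c : chart d, dom c x ;
  triv_bij : forall d (c : chart d) x, dom c x -> bijective (triv c x) ;
  triv_smooth : forall d (c c' : chart d),
    exists2 g : S2 -> 'M[R]_(rank c, rank c'),
      smooth_on (fun x : S2 => val x) (dom c `&` dom c') g &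
      forall x, dom c x -> dom c' x -> forall v,
        triv c x v = triv c' x (v *m g x) }.

Definition nerve_emb k (y : nerve k) : 'M[R]_(k.+1, 3) :=
  \matrix_(i < k.+1, j < 3) val (y i) 0 j.

(* In local trivializations of E^d near y_k and of E^{d+1-k} near y_0, the map
   F_k(y) is given by a matrix depending smoothly on y. *)
Definition smooth_cochain (E : gvbundle)
    (F : @cochain R nerve (fun x => gfib E (x ord0)) (fun x => gfib E (x ord0)))
    : Prop :=
  forall (k : nat) (d : int) (c : chart E d) (c' : chart E (d + 1 - k%:Z)),
  exists2 g : nerve k -> 'M[R]_(rank c, rank c'),
    smooth_on (@nerve_emb k) [set y | dom c (y ord_max) /\ dom c' (y ord0)] g &
    forall y : nerve k, dom c (y ord_max) -> dom c' (y ord0) -> forall v,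
      F k y (fun=> y ord_max) (fun=> y ord0) d (d + 1 - k%:Z)
        (triv c (y ord_max) v) = triv c' (y ord0) (v *m g y).

Record groupoid_ruth := GroupoidRuth {
  gbundle : gvbundle ;
  gop : @cochain R nerve (fun x => gfib gbundle (x ord0))
                         (fun x => gfib gbundle (x ord0)) ;
  gop_smooth : smooth_cochain gop ;
  gop_ruth : unital_ruth (PreRuth gop) }.

Definition nerve_ruth (F : groupoid_ruth) : preruth R nerve :=
  PreRuth (@gop F).

End sphere.
Arguments Delta : clear implicits.
Arguments cube : clear implicits.

(* Main.v *)
From mathcomp Require Import all_boot all_order all_algebra ring lra zify.
From mathcomp Require Import all_classical all_reals all_analysis.
Require Import Defs.

(** If two 2-simplices s, s' have the same boundary, then F_2(s) - F_2(s')
    anticommutes with F_0, hence induces a map H^d(E_{v_2}) -> H^{d-1}(E_{v_0}).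
    A quasi-isomorphism phi intertwines these maps for its source and its
    target, since the difference of phi_2 is a homotopy, so their vanishing is
    invariant under quasi-isomorphism. They vanish for a pullback along pi,
    because pi s = pi s'. For the integration of E, F_0 = 0 and the induced map
    is, up to sign, the difference of the integrals of eta over s and s'. This
    is nonzero when s' is constant and s collapses the boundary of Delta_2 to a
    point and covers S^2 with degree one. *)

Set Implicit Arguments.
Unset Strict Implicit.
Unset Printing Implicit Defensive.
Import Order.TTheory GRing.Theory Num.Theory.
Import numFieldNormedType.Exports.
Local Open Scope classical_set_scope.
Local Open Scope ring_scope.

(** * Two 2-simplices with the same boundary, and the invariance of their obstruction *)

Section two_simplices.
Variables (R : realType) (X : sset).

Lemma front_full k (s : X k) : front k s = s.
Proof.
rewrite -[RHS]act_id /front; congr (act _ _); apply: omap_eq => i /=.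
by apply: val_inj; rewrite /= inordK ?ltnS ?geq_minr// (minn_idPl (leq_ord i)).
Qed.

Lemma back_full k (s : X k) : back k s = s.
Proof.
rewrite -[RHS]act_id /back; congr (act _ _); apply: omap_eq => i /=.
apply: val_inj; rewrite /= subnn add0n inordK ?ltnS ?geq_minr//.
by rewrite (minn_idPl (leq_ord i)).
Qed.

Lemma front0 k (s : X k) : front 0 s = vtx 0 s.
Proof.
by rewrite /front /vtx; congr (act _ _); apply: omap_eq => i; rewrite /= ord1.
Qed.

Lemma back0 k (s : X k) : back 0 s = vtx k s.
Proof.
rewrite /back /vtx; congr (act _ _); apply: omap_eq => i.
by rewrite /= ord1 /= addn0 subn0.
Qed.

Lemma vtx0E (x : X 0%N) i : vtx i x = x.
Proof.
rewrite -[RHS]act_id /vtx; congr (act _ _); apply: omap_eq => j /=.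
by apply: val_inj; rewrite !ord1.
Qed.

(** Quantifying over all monotone maps into [2], and not only over the three cofaces, gives fronts,
    backs, vertices and faces by mere instantiation. *)
Definition same_boundary (s s' : X 2) :=
  forall m (f : omap m 2), (m < 2)%N -> act f s = act f s'.

Lemma same_boundary_front j (s s' : X 2) : same_boundary s s' -> (j < 2)%N ->
  front j s = front j s'.
Proof. by move=> ss' j2; apply: ss'. Qed.

Lemma same_boundary_back j (s s' : X 2) : same_boundary s s' -> (j < 2)%N ->
  back j s = back j s'.
Proof. by move=> ss' j2; apply: ss'. Qed.

Lemma same_boundary_vtx j (s s' : X 2) : same_boundary s s' ->
  vtx j s = vtx j s'.
Proof. by move=> ss'; apply: ss'. Qed.

Lemma same_boundary_face j (s s' : X 2) : same_boundary s s' ->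
  face j s = face j s'.
Proof. by move=> ss'; apply: ss'. Qed.

Lemma exprN12 : (-1) ^+ 2 = 1 :> R. Proof. by rewrite sqrrN expr1n. Qed.
Lemma exprN13 : (-1) ^+ 3 = -1 :> R. Proof. by rewrite exprS exprN12 mulr1. Qed.

(** Serves the structure equation with k = 2: [f] is the face term and [c] the product F_1 F_1, both
    shared by the two simplices; [a] and [b] are F_0 F_2 and F_2 F_0. *)
Lemma subr_cancel (V : zmodType) (f c a b a' b' : V) :
  f + (- a + c - b) = 0 -> f + (- a' + c - b') = 0 -> b - b' = - (a - a').
Proof.
rewrite !addrA => /eqP + /eqP; rewrite !subr_eq0 => /eqP <- /eqP <-.
by rewrite ![f - _ + c]addrAC [- (f + c - _)]opprD opprK addrACA subrr add0r
  opprD opprK.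
Qed.

(** Serves D(phi)_2 = 0: [u], [v] and [f] depend on the boundary only; [a], [b], [p], [q] are F'_0
    phi_2, F'_2 phi_0, phi_0 F_2 and phi_2 F_0. *)
Lemma subr_cancel2 (V : zmodType) (a a' b b' p p' q q' u v f : V) :
  a + u + b + (- p + v - q) + f = 0 -> a' + u + b' + (- p' + v - q') + f = 0 ->
  p - p' = b - b' + (a - a') + (- q - - q').
Proof.
have E c c' r t : c + u + c' + (- r + v - t) + f = c' + c - t + (u + v + f) - r.
  by rewrite !addrA [LHS](ACl (3*1*6*2*5*7*4)).
rewrite !E => /eqP + /eqP; rewrite !subr_eq0 => /eqP <- /eqP <-.
by rewrite opprD addrACA subrr addr0 !opprD addrACA [X in X + _]addrACA.
Qed.

(** Applied to the operator of a representation it is the obstruction; applied to a morphism it is a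
    homotopy between two obstructions. *)
Definition defect (E E' : gspaces R X) (F : cochain E E') (s s' : X 2)
    x y d d' (e : E x d) : E' y d' :=
  F 2%N s x y d d' e - F 2%N s' x y d d' e.

Lemma defectB (E E' : gspaces R X) (F : cochain E E') (s s' : X 2)
    x y d d' (e e' : E x d) :
  defect F s s' y d' (e - e') = defect F s s' y d' e - defect F s s' y d' e'.
Proof.
by rewrite /defect !linearB/= ?opprD ?opprK addrACA.
Qed.

Lemma defect0 (E E' : gspaces R X) (F : cochain E E') (s s' : X 2) x y d d' :
  defect F s s' y d' (0 : E x d) = 0.
Proof. by rewrite -[0 in LHS](subrr 0) defectB subrr. Qed.

Lemma cup0 (E E' E'' : gspaces R X) (G : cochain E' E'') (F : cochain E E')
    n k (s : X k) x y d d' (e : E x d) :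
  cup G F n 0 s y d' e =
  G 0%N (vtx 0 s) (vtx 0 s) y (d + n - k%:Z) d'
    (F k s x (vtx 0 s) d (d + n - k%:Z) e).
Proof. by rewrite /cup subn0 back_full front0. Qed.

Lemma cup_full (E E' E'' : gspaces R X) (G : cochain E' E'') (F : cochain E E')
    n k (s : X k) x y d d' (e : E x d) :
  cup G F n k s y d' e =
  G k s (vtx k s) y (d + n) d' (F 0%N (vtx k s) x (vtx k s) d (d + n) e).
Proof. by rewrite /cup subnn front_full back0 subr0. Qed.

Lemma cup1_same_boundary (E E' E'' : gspaces R X) (G : cochain E' E'')
    (F : cochain E E')
    n (s s' : X 2) x y d d' (e : E x d) : same_boundary s s' ->
  cup G F n 1 s y d' e = cup G F n 1 s' y d' e.
Proof.
move=> ss'; rewrite /cup /= !(same_boundary_front ss')//.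
by rewrite (same_boundary_back ss')// (same_boundary_vtx _ ss').
Qed.

Lemma ruth_defect (E : preruth R X) (s s' : X 2) : is_ruth E ->
  same_boundary s s' -> forall d (e : fib E (vtx 2 s) d),
  let x := vtx 2 s in let y := vtx 0 s in
  defect (op E) s s' y d (op E x x x d (d + 1) e) =
  - op E y y y (d - 1) d (defect (op E) s s' y (d - 1) e).
Proof.
move=> HE ss' d e x y.
(* Degrees are explicit arguments of cochains, so equal degrees are identified by rewriting, without
   transporting vectors. *)
have dE : d + 2 - 2%:Z = d by lia.
have d1E : d + 1 - 2%:Z = d - 1 by lia.
move: (HE 2%N s d e) (HE 2%N s').
rewrite -(same_boundary_vtx 2 ss') -(same_boundary_vtx 0 ss') => + /(_ d e).
cbv zeta. rewrite !dE.
rewrite !big_nat1 !big_ord_recr !big_ord0 /= !cup0 !cup_full.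
rewrite -(same_boundary_face _ ss') -(same_boundary_vtx 2 ss')
  -(same_boundary_vtx 0 ss').
rewrite (cup1_same_boundary _ _ _ _ _ _ ss') !d1E.
rewrite /defect linearB.
rewrite expr1 exprN12 exprN13 !scaleN1r !scale1r !add0r.
exact: subr_cancel.
Qed.

(** Subtracting D(phi)_2 = 0 for [s'] from the same equation for [s] leaves only the terms with an
    index 2 on one factor and 0 on the other. *)
Lemma closed_defect (E E' : preruth R X) (phi : cochain (fib E) (fib E'))
    (s s' : X 2) : closed_mor 0 phi ->
  same_boundary s s' -> forall d (e : fib E (vtx 2 s) d),
  let x := vtx 2 s in let y := vtx 0 s in
  phi 0%N y y y (d - 1) (d - 1) (defect (op E) s s' y (d - 1) e) =
  defect (op E') s s' y (d - 1) (phi 0%N x x x d d e)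
  + op E' y y y (d - 1 - 1) (d - 1) (defect phi s s' y (d - 1 - 1) e)
  - defect phi s s' y (d - 1) (op E x x x d (d + 1) e).
Proof.
move=> Hphi ss' d e x y.
have dE : d + 0 + 1 - 2%:Z = d - 1 by lia.
have d1E : d + 1 - 2%:Z = d - 1 by lia.
have d2E : d + 0 - 2%:Z = d - 1 - 1 by lia.
move: (Hphi 2%N s d e) (Hphi 2%N s').
rewrite /mor_diff.
rewrite -(same_boundary_vtx 2 ss') -(same_boundary_vtx 0 ss') => + /(_ d e).
cbv zeta.
rewrite !dE.
rewrite !big_nat1 !big_ord_recr !big_ord0 /= !cup0 !cup_full.
rewrite -(same_boundary_face _ ss') -(same_boundary_vtx 2 ss')
  -(same_boundary_vtx 0 ss').
rewrite !(cup1_same_boundary _ _ _ _ _ _ ss') !d1E !d2E !addr0.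
rewrite /defect !linearB /= !mulr0 expr0z.
have -> : (-1) ^ (0 + 1) = -1 :> R by [].
have -> : (-1) ^ (0 + 1%Z + 1) = 1 :> R by rewrite add0r -[RHS]exprN12.
have -> : (-1) ^ (0 + 2%Z + 1) = -1 :> R by rewrite add0r -[RHS]exprN13.
rewrite !scaleN1r !scale1r !add0r; exact: subr_cancel2.
Qed.

Lemma closed_mor0 (E E' : preruth R X) (phi : cochain (fib E) (fib E')) :
  closed_mor 0 phi -> forall (x : X 0%N) d (e : fib E x d),
  op E' x x x d (d + 1) (phi 0%N x x x d d e) =
  phi 0%N x x x (d + 1) (d + 1) (op E x x x d (d + 1) e).
Proof.
move=> H x; move: (H 0%N x); rewrite /mor_diff !vtx0E => + d e => /(_ d e).
rewrite !big_ord_recr !big_ord0 big_geq//= !cup0 !vtx0E !subr0 !addr0 !add0r.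
by rewrite mulr0 expr0z scale1r scaleN1r => /eqP; rewrite subr_eq0 => /eqP.
Qed.

(** Vanishing of the induced maps H^d(E_{v_2}) -> H^{d-1}(E_{v_0}). *)
Definition defect_trivial (E : preruth R X) (s s' : X 2) :=
  forall d (z : fib E (vtx 2 s) d), cocycle z ->
  coboundary (defect (op E) s s' (vtx 0 s) (d - 1) z).

(** Isolated from [is_ruth] because the first object of a zig-zag carries no such hypothesis; for
    the integration it follows at once from F_0 = 0. *)
Definition defect_anticommutes (E : preruth R X) (s s' : X 2) :=
  forall d (e : fib E (vtx 2 s) d), let x := vtx 2 s in let y := vtx 0 s in
  defect (op E) s s' y d (op E x x x d (d + 1) e) =
  - op E y y y (d - 1) d (defect (op E) s s' y (d - 1) e).

(** Injectivity of phi_0 in cohomology at v_0 is used: phi_0 sends the defect of [z] to that of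
    phi_0 z, which is exact, up to the coboundary of the defect of phi. *)
Lemma defect_trivial_forth (E E' : preruth R X)
    (phi : cochain (fib E) (fib E')) (s s' : X 2) :
  same_boundary s s' -> quasi_iso phi -> defect_anticommutes E s s' ->
  defect_trivial E' s s' -> defect_trivial E s s'.
Proof.
move=> ss' [phiD _ phiH] EA E'T d z Hz.
have [b Hb] : coboundary (defect (op E') s s' (vtx 0 s) (d - 1)
    (phi 0%N (vtx 2 s) (vtx 2 s) (vtx 2 s) d d z)).
  by apply: E'T; rewrite /cocycle closed_mor0// Hz linear0.
apply: (proj1 (phiH _ _)).
  by rewrite /cocycle subrK; apply/oppr_inj; rewrite -EA Hz defect0 oppr0.
exists (b + defect phi s s' (vtx 0 s) (d - 1 - 1) z).
by rewrite closed_defect // Hb Hz defect0 subr0 -linearD.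
Qed.

(** Surjectivity of phi_0 in cohomology at v_2 is used: [z] is phi_0 z' plus a coboundary F_0 b. The
    defect of phi_0 z' is exact by [closed_defect], and that of F_0 b by anticommutation. *)
Lemma defect_trivial_back (E E' : preruth R X)
    (phi : cochain (fib E') (fib E)) (s s' : X 2) :
  same_boundary s s' -> quasi_iso phi -> defect_anticommutes E s s' ->
  defect_trivial E' s s' -> defect_trivial E s s'.
Proof.
move=> ss' [phiD _ phiH] EA E'T d z Hz.
have [z' Hz' [b Hb]] := proj2 (phiH _ _) z Hz.
have [c Hc] := E'T _ _ Hz'.
have := closed_defect phiD ss' z'; cbv zeta; rewrite Hc Hz'.
have := closed_mor0 phiD c; rewrite subrK => <-.
rewrite defect0 subr0 => Hcz.
have := EA _ b; cbv zeta; rewrite subrK -Hb defectB => /eqP.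
rewrite subr_eq => /eqP ->; move/eqP: Hcz; rewrite -subr_eq => /eqP <-.
eexists; rewrite -linearB -linearN -linearD; reflexivity.
Qed.

(** Induction on the zig-zag: every object after the first is a representation, hence anticommutes
    by [ruth_defect]. *)
Lemma quasi_isomorphic_defect (E E' : preruth R X) (s s' : X 2) :
  same_boundary s s' -> quasi_isomorphic E E' -> defect_anticommutes E s s' ->
  defect_trivial E' s s' -> defect_trivial E s s'.
Proof.
move=> ss'; elim=> {E E'} [//|E E' E''|E E' E''] phi phiQ [E'R _] _ IH EA E''T.
- by apply: (defect_trivial_forth ss' phiQ EA); apply: IH E''T => d e;
  apply: ruth_defect.
- by apply: (defect_trivial_back ss' phiQ EA); apply: IH E''T => d e;
  apply: ruth_defect.
Qed.

Lemma defect_trivial_pullback (Y : sset) (f : smap X Y) (E : preruth R Y)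
    (s s' : X 2) : f 2%N s = f 2%N s' -> defect_trivial (pullback f E) s s'.
Proof.
by move=> fss' d z _; exists 0; rewrite /defect /= fss' subrr linear0.
Qed.
End two_simplices.

(** * Vanishing of iterated integrals with a zero factor *)

Section zero_forms.
Variable R : realType.

Definition null_form T V (a : hform R T V) := forall x v, tagged a x v = 0.

Lemma null_wedgel T V p q (a : form R T V p) (b : form R T V q) x v :
  (forall x v, a x v = 0) -> wedge a b x v = 0.
Proof. by move=> a0; rewrite /wedge big1 ?mulr0// => s _;
  rewrite a0 mul0r mulr0. Qed.

Lemma null_wedger T V p q (a : form R T V p) (b : form R T V q) x v :
  (forall x v, b x v = 0) -> wedge a b x v = 0.
Proof. by move=> b0; rewrite /wedge big1 ?mulr0// => s _;
  rewrite b0 !mulr0. Qed.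

Lemma null_wedges T V (I : Type) (a : I -> hform R T V) (r : seq I) :
  has (fun i => `[< null_form (a i) >]) r ->
    null_form (wedges [seq a i | i <- r]).
Proof.
elim: r => //= i r IH /orP[/asboolP a0|/IH r0] x v.
  exact: null_wedgel.
exact: null_wedger.
Qed.

Lemma null_hpull (V W : normedModType R) (f : V -> W) (a : hform R W W) :
  null_form a -> null_form (hpull f a).
Proof. by move=> a0 x v; apply: a0. Qed.

Lemma iterint0 m : iterint (fun _ : 'rV[R]_m => 0) = 0.
Proof.
elim: m => [//|m IH] /=; under eq_Rintegral do rewrite IH.
by rewrite /Rintegral integral0.
Qed.

Lemma null_int_form m (A : set 'rV[R]_m) w : null_form w -> int_form A w = 0.
Proof.
move=> w0; rewrite /int_form; case: ifP => // _.
rewrite -[RHS](iterint0 m); congr iterint; apply/funext => x.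
by rewrite w0 mulr0.
Qed.

Lemma null_psi k n (a : 'I_n -> hform R 'rV[R]_k 'rV[R]_k) i :
  null_form (a i) -> psi a = 0.
Proof.
case: n a i => [//|[|n]] a i ai0 /=.
  by rewrite (ord1 i) in ai0; rewrite null_int_form ?mulr0.
case: k a ai0 => // k a ai0.
rewrite null_int_form ?mulr0//; apply: null_hpull; apply: null_wedges.
by apply/hasP; exists i; [rewrite mem_enum|apply/asboolP/null_hpull].
Qed.

End zero_forms.

(** * Holonomies of d + eta *)

Lemma null_hpull_simplex (R : realType) k (s : Sing R k) (a : S2hform R) :
  null_form a -> null_form (hpull_simplex s a).
Proof.
by case: a => p a a0 t v; rewrite /= /pull_simplex; case: insub => // u;
  apply: a0.
Qed.

(** F_0 raises degrees by one, so the only matrix entry it can involve has row 1 and column 0. *)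
Lemma ord2_degrees (i j : 'I_2) (d : int) :
  (i : nat)%:Z = d + 1 -> (j : nat)%:Z = d -> i = ord_max /\ j = ord0.
Proof.
move: (ltn_ord i) (ltn_ord j) => i2 j2 id jd.
have [i1 j0] : (i : nat) = 1%N /\ (j : nat) = 0%N by lia.
by split; apply: val_inj.
Qed.

Section holonomy.
Variables (R : realType) (eta : S2form R 2) (Heta : smooth_form eta).
Local Notation E := (vol_superconnection Heta).

Lemma null_vol_cform k (s : Sing R k) (i j : 'I_2) :
  (i, j) != (ord0, ord_max) -> null_form (hpull_simplex s (vol_cform eta i j)).
Proof.
move=> ij; apply: null_hpull_simplex.
rewrite /vol_cform; case: ifP => // /andP[/eqP i0 /eqP j1]; case/eqP: ij.
by rewrite i0 j1; congr pair; apply: val_inj.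
Qed.

Lemma hol_summand0 k (s : Sing R k) n (c : {ffun 'I_n -> 'I_2 * 'I_2}) l :
  c l != (ord0, ord_max) -> @hol_summand R E k s n c = 0.
Proof.
move=> cl; rewrite /hol_summand /psibar (@null_psi _ _ _ _ l) ?mulr0 ?scale0r//.
by apply: null_vol_cform; rewrite -surjective_pairing.
Qed.

(** Either some factor carries a zero form, or the product of matrix units begins with E_01 E_01 =
    0. *)
Lemma hol_summand_ge2 k (s : Sing R k) n (c : {ffun 'I_n.+2 -> 'I_2 * 'I_2}) :
  @hol_summand R E k s n.+2 c = 0.
Proof.
have [c0|] := eqVneq (c ord0) (ord0, ord_max); last exact: hol_summand0.
have [c1|] := eqVneq (c (lift ord0 ord0)) (ord0, ord_max);
  last exact: hol_summand0.
rewrite /hol_summand !big_ord_recl c0 c1 /= mulmxA mul_delta_mx_cond /=.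
by rewrite mulr0n mul0mx scaler0.
Qed.

Let top : {ffun 'I_1 -> 'I_2 * 'I_2} := [ffun=> (ord0, ord_max)].

Lemma Hol_vol k (s : Sing R k) i j :
  Hol E s i j = (k == 1%N)%:R * (i == j)%:R + @hol_summand R E k s 1 top i j.
Proof.
(* The partial sums are constant once they contain the term of index 1. *)
rewrite mxE; congr (_ + _); apply: lim_near_cst => //; near=> n.
have n1 : (1 < n)%N by near: n; exists 2%N.
rewrite big_ltn//.
rewrite [X in _ + X]big_nat_cond [X in _ + X]big1 => [|m]; last first.
  rewrite andbT => /andP[m2 _].
  by case: m m2 => [|[|m]] // _; rewrite big1// => c _;
    rewrite hol_summand_ge2 mxE.
rewrite addr0 (bigD1 top)//= big1 ?addr0// => c ctop.
have [l cl] : exists l, c l != (ord0, ord_max).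
  apply/existsP; apply: contraNT ctop; rewrite negb_exists => /forallP H.
  by apply/eqP/ffunP => l; rewrite ffunE; apply/eqP; rewrite -[_ == _]negbK.
by rewrite (hol_summand0 _ cl) mxE.
Unshelve. all: by end_near. Qed.

Lemma Hol_vol0 (x : Sing R 0) : Hol E x ord_max ord0 = 0.
Proof.
rewrite Hol_vol mul0r add0r /hol_summand mxE [X in _ * X](_ : _ = 0) ?mulr0//.
by rewrite big_ord_recl big_ord0 mulmx1 ffunE mxE.
Qed.

(** [eps] is a product of signs, found by unification with the computed holonomy; only its being
    nonzero matters later. *)
Lemma Hol_vol2 : exists2 eps : R, eps != 0 &
  forall s : Sing R 2, Hol E s ord0 ord_max =
    eps * int_form (Delta R 2) (hpull_simplex s (Tagged (S2form R) eta)).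
Proof.
eexists; last first.
  move=> s; rewrite Hol_vol mul0r add0r /hol_summand /psibar /psi mxE
    [X in _ * X](_ : _ = 1); last first.
    by rewrite big_ord_recl big_ord0 mulmx1 ffunE mxE.
  rewrite !big_ord1 !ffunE mulr1 !mulrA /vol_cform.
  rewrite /sdeg /=; reflexivity.
by rewrite !mulf_neq0 ?signr_eq0 ?expfz_neq0 // oppr_eq0 oner_neq0.
Qed.

Lemma block_Hol0 (x : Sing R 0) d (e : vfib E d) :
  block (Hol E x) (d + 1) e = 0.
Proof.
apply/ffunP => i; rewrite !ffunE big1// => j _.
have [-> ->] := ord2_degrees (eqP (valP i)) (eqP (valP j)).
by rewrite Hol_vol0 mul0r.
Qed.

Lemma integration_op0 (x : Sing R 0) d e :
  op (integration E) x x x d (d + 1) e = 0.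
Proof. exact: block_Hol0. Qed.

Lemma integration_anticommutes s s' : defect_anticommutes (integration E) s s'.
Proof.
move=> d e x y; rewrite integration_op0 defect0.
have := @integration_op0 y _ (defect (op (integration E)) s s' y (d - 1) e).
by rewrite subrK => ->; rewrite oppr0.
Qed.

(** V^1 is a line, so the constant function 1 is its basis vector e_1; the index at which the image
    is read is that of e_0. *)
Lemma block_top (M : 'M[R]_2) :
  block (E := E) M 0 ([ffun=> 1] : vfib E 1) (exist _ ord0 (eqxx _)) =
    M ord0 ord_max.
Proof.
have H1 : bdeg (ord_max : 'I_(brank E)) == 1 by [].
rewrite !ffunE (bigD1 (exist _ ord_max H1))//= big1 ?addr0 ?ffunE ?mulr1//
  => j /eqP[].
apply: val_inj; apply: val_inj; have /eqP := valP j.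
by rewrite /= => -[].
Qed.

Lemma integration_defect s s' : defect_trivial (integration E) s s' ->
  int_form (Delta R 2) (hpull_simplex s (Tagged (S2form R) eta)) =
  int_form (Delta R 2) (hpull_simplex s' (Tagged (S2form R) eta)).
Proof.
move=> /(_ 1 [ffun=> 1]) [|b]; first exact: integration_op0.
(* Since F_0 = 0, an exact defect is zero. *)
have := @integration_op0 (vtx 0 s) _ b; rewrite subrK => -> /subr0_eq bE.
have HH : Hol E s ord0 ord_max = Hol E s' ord0 ord_max.
  apply: (etrans (esym (block_top (Hol E s)))).
  apply: (etrans _ (block_top (Hol E s'))).
  exact: (congr1 (fun f : vfib E 0 => f (exist _ ord0 (eqxx _))) bE).
have [eps eps0 HolE] := Hol_vol2.
apply: (mulfI eps0); exact: (etrans (esym (HolE s)) (etrans HH (HolE s'))).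
Qed.
End holonomy.

(** * Bounds for integrals over the line and the plane *)

Section integral_bounds.
Variable R : realType.
Local Notation mu := (@lebesgue_measure R).

(* The integral of a nonnegative function is the supremum of the integrals of
   the simple functions below it, be it measurable or not. *)
Lemma ge0_le_integralT (f g : R -> \bar R) :
  (forall x, 0 <= f x)%E -> (forall x, f x <= g x)%E ->
  (\int[mu]_x f x <= \int[mu]_x g x)%E.
Proof.
move=> f0 fg; have g0 x : (0 <= g x)%E by apply: le_trans (fg x).
rewrite !ge0_integralTE//; apply: ge_ereal_sup => _ [h /= hf <-].
by apply: ereal_sup_ubound; exists h => //= x; apply: le_trans (fg x).
Qed.

Lemma integral_box (c a b : R) : a <= b ->
  (\int[mu]_x (((cst c%:E) \_ `[a, b]) x) = (c * (b - a))%:E)%E.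
Proof.
move=> ab; rewrite -integral_mkcond integral_cst; last exact: measurable_itv.
rewrite [X in (_ * X)%E](_ : _ = (b - a)%:E) ?EFinM//.
by rewrite /= lebesgue_measure_itv/= lte_fin; case: ltgtP ab => // -> _;
  rewrite subrr.
Qed.

(** Compare [f] with step functions supported on [a, b] and on [0, 1]. The upper one also makes the
    integral finite, so that its real value is not the default 0. *)
Lemma Rintegral_bounds (f : R -> R) (c a b M : R) : 0 <= c -> a <= b ->
  (forall x, 0 <= f x) -> (forall x, a <= x <= b -> c <= f x) ->
  (forall x, 0 <= x <= 1 -> f x <= M) ->
  (forall x, ~~ (0 <= x <= 1) -> f x = 0) ->
  c * (b - a) <= \int[mu]_x f x <= M.
Proof.
move=> c0 ab f0 fc fM f01; rewrite /Rintegral.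
have I0 : (0 <= \int[mu]_x (f x)%:E)%E by apply: integral_ge0 => x _;
  rewrite lee_fin.
have lb : ((c * (b - a))%:E <= \int[mu]_x (f x)%:E)%E.
  rewrite -integral_box//; apply: ge0_le_integralT => x; rewrite patchE.
    by case: ifP; rewrite ?lee_fin.
  by case: ifPn; rewrite ?lee_fin// inE/= in_itv/=; apply: fc.
have ub : (\int[mu]_x (f x)%:E <= M%:E)%E.
  rewrite -[M in leRHS]mulr1 -[X in _ * X]subr0 -integral_box ?ler01//.
  apply: ge0_le_integralT => x; rewrite ?patchE ?lee_fin//.
  case: ifPn; rewrite ?inE ?notin_setE/= ?in_itv/= lee_fin; first exact: fM.
  by move=> /negP/f01 ->.
have Ifin : (\int[mu]_x (f x)%:E)%E \is a fin_num.
  by rewrite ge0_fin_numE// (le_lt_trans ub)// ltry.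
by rewrite -!lee_fin fineK// lb.
Qed.

(** Nested exactly as in the unfolding of [iterint], so that [iterint2E] holds by computation. *)
Definition point2 (x y : R) : 'rV[R]_2 :=
  row_mx (x%:M : 'rV_1) (row_mx (y%:M : 'rV_1) (0 : 'rV_0)).

Lemma point2_0 x y : point2 x y 0 0 = x.
Proof.
rewrite /point2 (_ : 0 = lshift 1 (0 : 'I_1)); last exact: val_inj.
by rewrite (@row_mxEl _ 1 1 1) mxE.
Qed.

Lemma point2_1 x y : point2 x y 0 1 = y.
Proof.
rewrite /point2 (_ : (1 : 'I_2) = rshift 1 (0 : 'I_1)); last exact: val_inj.
rewrite (@row_mxEr _ 1 1 1) (_ : 0 = lshift 0 (0 : 'I_1)); last exact: val_inj.
by rewrite (@row_mxEl _ 1 1 0) mxE.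
Qed.

Lemma iterint2E (f : 'rV[R]_2 -> R) :
  iterint f = \int[mu]_x \int[mu]_y f (point2 x y).
Proof. by []. Qed.

(** The inner integral is at least c (b' - a') for x in [a, b]; integrating once more gives the
    lower bound c (b' - a') (b - a). *)
Lemma iterint2_gt0 (f : 'rV[R]_2 -> R) (c M a b a' b' : R) :
  0 < c -> a < b -> a' < b' -> (forall t, 0 <= f t <= M) ->
  (forall t, f t != 0 -> cube R 2 t) ->
  (forall x y, a <= x <= b -> a' <= y <= b' -> c <= f (point2 x y)) ->
  0 < iterint f.
Proof.
move=> c0 ab ab' f0 fcube fc; rewrite iterint2E.
have f0x x y : ~~ (0 <= x <= 1) -> f (point2 x y) = 0.
  by move=> x01; apply: contraNeq x01 => /fcube /(_ 0); rewrite point2_0.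
have f0y x y : ~~ (0 <= y <= 1) -> f (point2 x y) = 0.
  by move=> x01; apply: contraNeq x01 => /fcube /(_ 1); rewrite point2_1.
have bd x : 0 <= \int[mu]_y f (point2 x y) <= M.
  have := @Rintegral_bounds (fun y => f (point2 x y)) 0 0 0 M; rewrite mul0r.
  apply=> // [y|y _|y _|y]; by [case/andP: (f0 (point2 x y))|apply: f0y].
suff /andP[+ _] : c * (b' - a') * (b - a) <=
    \int[mu]_x \int[mu]_y f (point2 x y) <= M.
  by apply: lt_le_trans; rewrite !mulr_gt0 ?subr_gt0.
apply: Rintegral_bounds; rewrite ?(ltW ab)//.
- by rewrite mulr_ge0 ?subr_ge0// ltW.
- by move=> x; case/andP: (bd x).
- move=> x xab.
  suff /andP[] : c * (b' - a') <= \int[mu]_y f (point2 x y) <= M by [].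
  apply: Rintegral_bounds; rewrite ?(ltW ab') ?(ltW c0)//.
  + by move=> y; case/andP: (f0 (point2 x y)).
  + by move=> y yab; apply: fc.
  + by move=> y _; case/andP: (f0 (point2 x y)).
  + exact: f0y.
- by move=> x _; case/andP: (bd x).
- by move=> x x01; rewrite /Rintegral integral0_eq// => y _; rewrite f0x.
Qed.

Lemma iterint2N (f : 'rV[R]_2 -> R) : (forall t, 0 <= f t) ->
  iterint (fun t => - f t) = - iterint f.
Proof.
have N (g : R -> R) : (forall x, 0 <= g x) ->
  \int[mu]_x - g x = - \int[mu]_x g x.
  by move=> g0; rewrite /Rintegral -fineN -integral_ge0N// => x _;
    rewrite lee_fin.
move=> f0; rewrite !iterint2E -N.
  by apply: eq_Rintegral => x _; rewrite N.
by move=> x; apply: Rintegral_ge0.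
Qed.

End integral_bounds.

(** * Rational maps without poles: smoothness and derivatives *)

Section rational_maps.
Variables (R : realType) (m : nat).

(** A syntax closed under differentiation: smoothness becomes an induction, and derivatives of
    concrete maps are obtained by evaluation. *)
Inductive rexpr :=
  | Cst of R
  | Var of 'I_m
  | Add of rexpr & rexpr
  | Mul of rexpr & rexpr
  | Inv of rexpr.

Fixpoint reval (e : rexpr) (x : 'rV[R]_m) : R :=
  match e with
  | Cst c => c
  | Var i => x 0 i
  | Add e f => reval e x + reval f x
  | Mul e f => reval e x * reval f x
  | Inv e => (reval e x)^-1
  end.

Fixpoint rwf (e : rexpr) : Prop :=
  match e with
  | Cst _ | Var _ => True
  | Add e f | Mul e f => rwf e /\ rwf f
  | Inv e => rwf e /\ forall x, reval e x != 0
  end.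

Fixpoint rderiv (v : 'rV[R]_m) (e : rexpr) : rexpr :=
  match e with
  | Cst _ => Cst 0
  | Var i => Cst (v 0 i)
  | Add e f => Add (rderiv v e) (rderiv v f)
  | Mul e f => Add (Mul e (rderiv v f)) (Mul f (rderiv v e))
  | Inv e => Mul (Mul (Cst (-1)) (Mul (Inv e) (Inv e))) (rderiv v e)
  end.

Lemma rwf_deriv v e : rwf e -> rwf (rderiv v e).
Proof. by elim: e => //= [e IHe f IHf|e IHe f IHf|e IHe] []; do ?split;
  auto. Qed.

Lemma differentiable_reval e x : rwf e ->
  differentiable (reval e : 'rV[R]_m -> R^o) x.
Proof.
elim: e => /= [c _|i _|e IHe f IHf [we wf]|e IHe f IHf [we wf]|e IHe [we e0]].
- exact: differentiable_cst.
- exact: differentiable_coord.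
- by apply: differentiableD; auto.
- by apply: differentiableM; auto.
- by apply: differentiableV; auto.
Qed.

Lemma derive_reval e v x : rwf e ->
  'D_v (reval e : 'rV[R]_m -> R^o) x = reval (rderiv v e) x.
Proof.
have dr f : rwf f -> derivable (reval f : 'rV[R]_m -> R^o) x v.
  by move=> ?; apply/diff_derivable/differentiable_reval.
elim: e => /= [c _|i _|e IHe f IHf [we wf]|e IHe f IHf [we wf]|e IHe [we e0]].
- exact: derive_cst.
(* A coordinate is an entry of the identity map, which is differentiated entrywise. *)
- have /matrixP/(_ 0 i) := @derive_mx R _ 1 m id x v (@derivable_id _ _ x v).
  by rewrite derive_id mxE => ->.
- by rewrite (deriveD (dr _ we) (dr _ wf)) IHe ?IHf.
- by rewrite (deriveM (dr _ we) (dr _ wf)) IHe ?IHf.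
- by rewrite (deriveV (e0 x) (dr _ we)) IHe// -exprVn expr2 mulN1r.
Qed.

Definition rmap n (F : 'I_n -> rexpr) (x : 'rV[R]_m) : 'rV[R]_n :=
  \row_j reval (F j) x.

Lemma differentiable_rmap n (F : 'I_n -> rexpr) x : (forall j, rwf (F j)) ->
  differentiable (rmap F) x.
Proof.
move=> wF; have -> : rmap F = \sum_j (fun x => reval (F j) x *: delta_mx 0 j).
  apply/funext => y; rewrite fct_sumE; apply/rowP => j.
  rewrite !mxE summxE (bigD1 j)//= !mxE !eqxx mulr1 big1 ?addr0// => i ij.
  by rewrite !mxE eq_sym (negbTE ij) andbF mulr0.
by apply: differentiable_sum => j; apply/differentiableZl/differentiable_reval.
Qed.

Lemma derive_rmap n (F : 'I_n -> rexpr) v x : (forall j, rwf (F j)) ->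
  'D_v (rmap F) x = rmap (fun j => rderiv v (F j)) x.
Proof.
move=> wF; rewrite derive_mx; last first.
  exact/diff_derivable/differentiable_rmap.
apply/rowP => j; rewrite !mxE -derive_reval//; congr ('D_v _ x).
by apply/funext => y; rewrite mxE.
Qed.

(** Directional derivatives are again maps of this kind, so the induction on the order goes through
    for all [F] at once. *)
Lemma smooth_rmap n (F : 'I_n -> rexpr) U : (forall j, rwf (F j)) ->
  is_Cinf U (rmap F).
Proof.
move=> wF k; elim: k F wF => [|k IH] F wF /=.
  by move=> x _; apply/differentiable_continuous/differentiable_rmap.
split=> [x _|v]; first exact: differentiable_rmap.
have -> : 'D_v (rmap F) = rmap (fun j => rderiv v (F j)).
  by apply/funext => x; apply: derive_rmap.
by apply: IH => j; apply: rwf_deriv.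
Qed.

End rational_maps.

(** * Independence of derivatives on simplices from the extension *)

(* The derivatives of f at a towards the other points of a convex set are
   one-sided, hence determined by the restriction of f to this set. *)
Lemma derive_eq_on (R : realType) (V W : normedModType R) (U A : set V)
    (f g : V -> W) (a v : V) :
  open U -> U a -> (forall b, A b -> U b -> f b = g b) ->
  (forall h : R, 0 <= h <= 1 -> A (h *: v + a)) ->
  derivable f a v -> derivable g a v -> 'D_v f a = 'D_v g a.
Proof.
move=> oU Ua fg Av df dg; apply/eqP; rewrite -subr_eq0 -deriveB//; apply/eqP.
have dfg : derivable (f - g) a v by apply: derivableB.
have fga : (f - g) a = 0.
  apply/eqP; rewrite subr_eq0; apply/eqP; apply: fg => //.
  by rewrite -[a]add0r -(scale0r v); apply: Av; rewrite lexx ler01.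
pose q h := h^-1 *: (((f - g) \o shift a) (h *: v) - (f - g) a).
have qD : q @ 0^'+ --> 'D_v (f - g) a.
  have {}dfg : q @ 0^' --> 'D_v (f - g) a by exact: dfg.
  move=> B /dfg; rewrite /= !nbhs_simpl /= /dnbhs /at_right /within.
  apply: (@filterS _ (nbhs (0 : R))) => h H h0; apply: H.
  by rewrite /= gt_eqF.
rewrite -(cvg_lim _ qD)//; apply: lim_near_cst => //.
have cont : {for 0, continuous (fun h : R => h *: v + a)}.
  apply: cvgD; last exact: cvg_cst.
  by apply: cvgZr_tmp; exact: cvg_id.
near=> h.
rewrite /q fga subr0 /=.
have -> : (f - g) (h *: v + a) = 0.
  apply/eqP; rewrite subr_eq0; apply/eqP; apply: fg; first apply: Av.
    by apply/andP; split; near: h; [apply: nbhs_right_ge|apply: nbhs_right_le].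
  near: h; apply: cvg_within; apply: cont; rewrite scale0r add0r.
  exact: open_nbhs_nbhs.
exact: scaler0.
Unshelve. all: by end_near. Qed.

Section derivatives_on_simplices.
Variable R : realType.

Lemma Delta_convex k (a b : 'rV[R]_k) (h : R) : 0 <= h <= 1 ->
  Delta R k a -> Delta R k b -> Delta R k (h *: (b - a) + a).
Proof.
move=> /andP[h0 h1] [a01 aD] [b01 bD].
have E i : (h *: (b - a) + a) 0 i = h * b 0 i + (1 - h) * a 0 i.
  by rewrite !mxE; ring.
have h1' : 0 <= 1 - h by rewrite subr_ge0.
split=> [i|i j ij]; rewrite !E; last first.
  by rewrite lerD ?ler_wpM2l ?aD ?bD.
move: (a01 i) (b01 i) => /andP[a0 a1] /andP[b0 b1].
by rewrite addr_ge0 ?mulr_ge0//=; nra.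
Qed.

(** The vectors from [a] to the vertices span: differences of consecutive ones are the standard
    basis vectors. *)
Lemma linear_eq_vert k (W : lmodType R) (L L' : {linear 'rV[R]_k -> W})
    (a v : 'rV[R]_k) :
  (forall i, L (vert R k i - a) = L' (vert R k i - a)) -> L v = L' v.
Proof.
move=> LL'; have E (j : 'I_k) :
    delta_mx 0 j = (vert R k j.+1 - a) - (vert R k j - a).
  apply/rowP => l; rewrite opprB addrA subrK !mxE eqxx/= ltnS.
  by rewrite -val_eqE /=; case: ltngtP => _; rewrite ?subrr ?subr0.
rewrite [v]row_sum_delta !linear_sum; apply: eq_bigr => j _.
rewrite !linearZ/= E; congr (_ *: _); move: (LL' j.+1) (LL' j).
by move: (vert _ _ _ - _) (vert _ _ _ - _) => p q Lp Lq;
  rewrite !linearB/= Lp Lq.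
Qed.

(** [tderiv] picks an arbitrary smooth extension. By convexity it agrees with [g] along the segments
    from [a] to the vertices, whose directions span. *)
Lemma tderiv_ext k (W : normedModType R) (f : Delta R k -> W)
    (g : 'rV[R]_k -> W)    (a : Delta R k) (v : 'rV[R]_k) :
  is_Cinf setT g -> (forall b, f b = g (val b)) ->
  tderiv f a v = 'D_v g (val a).
Proof.
move=> gC fg; rewrite /tderiv.
have [U [oU Ua fC ff]] : smooth_ext (fun b : Delta R k => val b) setT f a
    (get (smooth_ext (fun b : Delta R k => val b) setT f a)).
  by apply: getPex; exists g, setT; split=> //; exact: openT.
move: (get _) fC ff => f' fC ff.
have df' : differentiable f' (val a) by have [H _] := fC 1%N; apply: H.
have dg : differentiable g (val a) by have [H _] := gC 1%N; apply: H.
have Evert i : 'd f' (val a) (vert R k i - val a) =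
  'd g (val a) (vert R k i - val a).
  rewrite -!deriveE//; apply: (@derive_eq_on _ _ _ U (Delta R k)) => //.
  - move=> b Db Ub; pose b' : Delta R k := exist _ b (mem_set Db).
    by rewrite -(fg b') (ff b').
  - move=> h h01; apply: Delta_convex => //; first exact: (set_mem (valP a)).
    exact: vert_Delta.
  - exact: diff_derivable.
  - exact: diff_derivable.
rewrite (deriveE v df') (deriveE v dg).
exact: (linear_eq_vert v Evert).
Qed.

End derivatives_on_simplices.

(** * Cross products in three-space *)

Section vectors3.
Variable R : realType.
Implicit Types u v w : 'rV[R]_3.

Definition o0 : 'I_3 := Ordinal (isT : 0 < 3)%N.
Definition o1 : 'I_3 := Ordinal (isT : 1 < 3)%N.
Definition o2 : 'I_3 := Ordinal (isT : 2 < 3)%N.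

Definition vec3 (a b c : R) : 'rV[R]_3 :=
  \row_i (if i == o0 then a else if i == o1 then b else c).

Lemma vec3E a b c :
  (vec3 a b c 0 o0 = a) * (vec3 a b c 0 o1 = b) * (vec3 a b c 0 o2 = c).
Proof. by rewrite !mxE. Qed.

Lemma forall_ord3 (P : 'I_3 -> Prop) : P o0 -> P o1 -> P o2 -> forall i, P i.
Proof.
by move=> P0 P1 P2 [[|[|[|i]]] i3] //; [move: P0|move: P1|move: P2];
   congr P; apply: val_inj.
Qed.

Lemma eq_vec3 u v : u 0 o0 = v 0 o0 -> u 0 o1 = v 0 o1 -> u 0 o2 = v 0 o2 ->
  u = v.
Proof. by move=> ? ? ?; apply/rowP; apply: forall_ord3. Qed.

Lemma dot3E u v : dot u v = u 0 o0 * v 0 o0 + u 0 o1 * v 0 o1 + u 0 o2 * v 0 o2.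
Proof.
rewrite /dot !big_ord_recr big_ord0 /= add0r.
by congr (_ * _ + _ * _ + _ * _); congr (_ _); apply: val_inj.
Qed.

Definition cross u v : 'rV[R]_3 :=
  vec3 (u 0 o1 * v 0 o2 - u 0 o2 * v 0 o1)
       (u 0 o2 * v 0 o0 - u 0 o0 * v 0 o2)
       (u 0 o0 * v 0 o1 - u 0 o1 * v 0 o0).

Definition det3 u v w : R := dot u (cross v w).

Lemma dot_cross u v : dot v (cross u v) = 0.
Proof. by rewrite dot3E !vec3E; ring. Qed.

(** This is the expansion v (u.u) - u (u.v). It makes each tangent vector v at u the value of a
    rotation field x |-> w \times x, with w = u \times v. *)
Lemma cross_cross u v : dot u u = 1 -> dot u v = 0 -> cross (cross u v) u = v.
Proof.
rewrite !dot3E => uu uv; apply: eq_vec3; rewrite !vec3E.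
- transitivity (v 0 o0 * (u 0 o0 * u 0 o0 + u 0 o1 * u 0 o1 + u 0 o2 * u 0 o2)
    - u 0 o0 * (u 0 o0 * v 0 o0 + u 0 o1 * v 0 o1 + u 0 o2 * v 0 o2)).
    ring.
  by rewrite uu uv; ring.
- transitivity (v 0 o1 * (u 0 o0 * u 0 o0 + u 0 o1 * u 0 o1 + u 0 o2 * u 0 o2)
    - u 0 o1 * (u 0 o0 * v 0 o0 + u 0 o1 * v 0 o1 + u 0 o2 * v 0 o2)).
    ring.
  by rewrite uu uv; ring.
- transitivity (v 0 o2 * (u 0 o0 * u 0 o0 + u 0 o1 * u 0 o1 + u 0 o2 * u 0 o2)
    - u 0 o2 * (u 0 o0 * v 0 o0 + u 0 o1 * v 0 o1 + u 0 o2 * v 0 o2)).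
    ring.
  by rewrite uu uv; ring.
Qed.

Lemma cross_basis u v : cross u v = u 0 o0 *: cross (vec3 1 0 0) v
  + (u 0 o1 *: cross (vec3 0 1 0) v + u 0 o2 *: cross (vec3 0 0 1) v).
Proof. by apply: eq_vec3; rewrite !mxE/=; ring. Qed.

End vectors3.

(** * Two-forms on the sphere and their densities *)

Section two_forms.
Variables (R : realType) (eta : S2form R 2) (Heta : smooth_form eta).
Implicit Types (u v w : 'rV[R]_3) (x : S2 (R:=R)).

Definition pair2 u v : 'I_2 -> 'rV[R]_3 := fun i => if i == 0 then u else v.

Let B x u v := eta x (pair2 u v).

Lemma tangent0 x : tangent x 0.
Proof. by rewrite /tangent /dot big1// => i _; rewrite mxE mulr0. Qed.

Lemma tangentD x u v : tangent x u -> tangent x v -> tangent x (u + v).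
Proof.
rewrite /tangent => Tu Tv; transitivity (dot (val x) u + dot (val x) v).
  by rewrite /dot -big_split; apply: eq_bigr => i _; rewrite !mxE mulrDr.
by rewrite Tu Tv addr0.
Qed.

Lemma tangentZ x c u : tangent x u -> tangent x (c *: u).
Proof.
rewrite /tangent => Tu; transitivity (c * dot (val x) u).
  by rewrite /dot mulr_sumr; apply: eq_bigr => i _; rewrite mxE mulrCA.
by rewrite Tu mulr0.
Qed.

Lemma tangent_pair2 x u v : tangent x u -> tangent x v ->
  forall i, tangent x (pair2 u v i).
Proof. by move=> Tu Tv i; rewrite /pair2; case: ifP. Qed.

Lemma form2_linearl x c u v w : tangent x u -> tangent x v -> tangent x w ->
  B x (c *: u + v) w = c * B x u w + B x v w.
Proof.
move=> Tu Tv Tw; have [L _] := proj1 Heta x.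
have E z : pair2 z w = [eta pair2 0 w with 0 |-> z].
  by apply/funext => i; rewrite /pair2 /=; case: eqP.
rewrite /B (E (_ + _)) L -?(E u) -?(E v)//.
exact/tangent_pair2/Tw/tangent0.
Qed.

Lemma form2_linearr x c u v w : tangent x u -> tangent x v -> tangent x w ->
  B x w (c *: u + v) = c * B x w u + B x w v.
Proof.
move=> Tu Tv Tw; have [L _] := proj1 Heta x.
have E z : pair2 w z = [eta pair2 w 0 with 1 |-> z].
  apply/funext => i; rewrite /pair2 /=; case: (i =P 1) => [->|] //.
  by case: i => [[|[|i]]] //= i2 H; case: H; apply: val_inj.
rewrite /B (E (_ + _)) L -?(E u) -?(E v)//.
exact/tangent_pair2/tangent0.
Qed.

Lemma form2_alt x u : tangent x u -> B x u u = 0.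
Proof.
move=> Tu; have [_ Z] := proj1 Heta x.
by apply: (Z _ 0 1) => //; apply: tangent_pair2.
Qed.

Lemma form2_anti x u v : tangent x u -> tangent x v -> B x u v = - B x v u.
Proof.
move=> Tu Tv; have := form2_alt (tangentD Tu Tv).
rewrite -{1}[u]scale1r form2_linearl//; last exact: tangentD.
rewrite -[u]scale1r !form2_linearr ?scale1r// !form2_alt// !mul1r addr0 add0r.
by move/eqP; rewrite addr_eq0 => /eqP.
Qed.

(* The components of eta along the smooth tangent fields x |-> w \times x. *)
Definition density x : R :=
  val x 0 o0 * B x (cross (vec3 0 1 0) (val x)) (cross (vec3 0 0 1) (val x)) +
  val x 0 o1 * B x (cross (vec3 0 0 1) (val x)) (cross (vec3 1 0 0) (val x)) +
  val x 0 o2 * B x (cross (vec3 1 0 0) (val x)) (cross (vec3 0 1 0) (val x)).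

(** Expand [u] and [v] in the rotation fields about the axes. The coefficients combine by (x \times
    u) \times (x \times v) = det(x, u, v) x, so [density] is the ratio of eta to the standard area
    form. *)
Lemma form2_density x u v : tangent x u -> tangent x v ->
  eta x (pair2 u v) = density x * det3 (val x) u v.
Proof.
move=> Tu Tv; have xx : dot (val x) (val x) = 1 by exact: (set_mem (valP x)).
have T w : tangent x (cross w (val x)) by apply: dot_cross.
have expand (a b c w : 'rV[R]_3) (r s t : R) : tangent x a -> tangent x b ->
    tangent x c -> tangent x w ->
    B x (r *: a + (s *: b + t *: c)) w =
      r * B x a w + (s * B x b w + t * B x c w).
  move=> Ta Tb Tc Tw; rewrite !form2_linearl//;
    do ?[exact: tangentZ|apply: tangentD].
  congr (_ + (_ + _)); have := form2_linearl t Tc (tangent0 x) Tw.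
  (* With coefficient -1 and both vectors 0, linearity says that the form vanishes on 0. *)
  have := form2_linearl (-1) (tangent0 x) (tangent0 x) Tw.
  by rewrite scaler0 addr0 mulN1r addNr => ->; rewrite !addr0.
have Eu := cross_basis (cross (val x) u) (val x).
have Ev := cross_basis (cross (val x) v) (val x).
rewrite !cross_cross// in Eu Ev.
rewrite -/(B x u v) {1}Eu expand// !(form2_anti (T _) Tv) {1 2 3}Ev !expand//.
rewrite !form2_alt// /density.
rewrite (form2_anti (T (vec3 0 1 0)) (T (vec3 1 0 0))).
rewrite (form2_anti (T (vec3 0 0 1)) (T (vec3 0 1 0))).
rewrite (form2_anti (T (vec3 1 0 0)) (T (vec3 0 0 1))).
rewrite /det3 dot3E !vec3E.
ring.
Qed.

(** Continuity on the sphere is expressed by composing with maps [p] into it that are continuous as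
    maps into three-space. *)
Lemma continuous_smooth_on (W : normedModType R) (T : topologicalType)
    (f : S2 (R:=R) -> W) (p : T -> S2 (R:=R)) :
  smooth_on (fun x : S2 (R:=R) => val x) setT f -> continuous (val \o p) ->
  continuous (f \o p).
Proof.
move=> fs pc t; have [g [U [oU Ut gC fg]]] := fs (p t) I.
have gc : {for val (p t), continuous g} by apply: (gC 0%N).
apply: (@cvg_trans _ ((g \o (val \o p)) @ t)); last first.
  rewrite /= (fg (p t))//; exact: (continuous_comp (pc t) gc).
apply: near_eq_cvg; near=> s; rewrite /= (fg (p s))//.
by near: s; apply: (pc t); apply: open_nbhs_nbhs.
Unshelve. all: by end_near. Qed.

Lemma continuous_density (T : topologicalType) (p : T -> S2 (R:=R)) :
  continuous (val \o p) -> continuous (density \o p : T -> R^o).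
Proof.
move=> pc t; rewrite /density.
have cc i : {for t, continuous (fun s => val (p s) 0 i : R^o)}.
  by apply: (continuous_comp (pc t) (g := fun u : 'rV[R]_3 => u 0 i : R^o));
    exact: coord_continuous.
have cB w z : {for t, continuous (fun s =>
  B (p s) (cross w (val (p s))) (cross z (val (p s))) : R^o)}.
  pose Z (i : 'I_2) (x : S2 (R:=R)) := cross (pair2 w z i) (val x).
  have Zs i : smooth_field (Z i).
    split=> [x _|x]; last exact: dot_cross.
    (* The field is linear in the point; writing it with [rexpr] gives its smoothness. *)
    pose c (k : 'I_3) := pair2 w z i 0 k.
    pose term (k l : 'I_3) :=
      Add (Mul (Cst 3 (c k)) (Var R l)) (Mul (Cst 3 (- c l)) (Var R k)).
    exists (rmap (fun j => if j == o0 then term o1 o2 else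
      if j == o1 then term o2 o0 else term o0 o1)), setT; split=> //.
    - exact: openT.
    - apply: smooth_rmap; apply: forall_ord3 => //=.
    - by move=> y _ _; apply: eq_vec3; rewrite !mxE /= /c; ring.
  have := continuous_smooth_on (proj2 Heta Z Zs) pc (x := t).
  congr continuous_at; apply/funext => s; rewrite /B /=; congr (eta _ _).
  by apply/funext => i; rewrite /Z /pair2; case: ifP.
by apply: cvgD; first apply: cvgD; apply: cvgM; do ?[exact: cc|exact: cB].
Qed.
End two_forms.

(** * A 2-simplex collapsing the boundary and wrapping the sphere *)

Lemma int_formE (R : realType) m (A : set 'rV[R]_m)
    (w : form R 'rV[R]_m 'rV[R]_m m) :
  int_form A (Tagged (form R 'rV[R]_m 'rV[R]_m) w) =
  iterint (fun x => \1_A x * w x (fun i => stdvec R m i)).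
Proof. by rewrite /int_form eqxx. Qed.

Lemma forall_ord2 (P : 'I_2 -> Prop) : P 0 -> P 1 -> forall i, P i.
Proof.
by move=> P0 P1 [[|[|i]] i2] //; [move: P0|move: P1]; congr P; apply: val_inj.
Qed.

(* With w = (ex, ey) = t - (2/3, 1/3) and z = ez the product of the barycentric
   coordinates of t, collapse t = (2 z w, z^2 - |w|^2) / (z^2 + |w|^2) is the
   inverse stereographic projection of w / z. *)
Section collapse.
Variable R : realType.
Implicit Type t : 'rV[R]_2.

Definition ex : rexpr R 2 := Add (Var R 0) (Cst 2 (- (2 / 3))).
Definition ey : rexpr R 2 := Add (Var R 1) (Cst 2 (- (1 / 3))).
Definition ez : rexpr R 2 :=
  Mul (Mul (Add (Cst 2 1) (Mul (Cst 2 (-1)) (Var R 0)))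
           (Add (Var R 0) (Mul (Cst 2 (-1)) (Var R 1)))) (Var R 1).
Definition enorm : rexpr R 2 := Add (Mul ez ez) (Add (Mul ex ex) (Mul ey ey)).

Definition ecollapse (j : 'I_3) : rexpr R 2 :=
  Mul (if j == o0 then Mul (Cst 2 2) (Mul ez ex)
       else if j == o1 then Mul (Cst 2 2) (Mul ez ey)
       else Add (Mul ez ez) (Mul (Cst 2 (-1)) (Add (Mul ex ex) (Mul ey ey))))
      (Inv enorm).

(** The factor 4 z^4 / (z^2 + |w|^2)^2 of inverse stereographic projection at w / z, times the
    Jacobian (z - x z_x - y z_y) / z^3 of w / z, where w = (x, y). *)
Definition ejacobian : rexpr R 2 :=
  Mul (Mul (Cst 2 4) (Mul ez
    (Add ez (Mul (Cst 2 (-1))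
       (Add (Mul ex (rderiv (stdvec R 2 0) ez))
            (Mul ey (rderiv (stdvec R 2 1) ez)))))))
    (Mul (Inv enorm) (Inv enorm)).

(** The vector w vanishes only at the barycenter (2/3, 1/3), where z = 1/27. *)
Lemma enorm_gt0 t : 0 < reval enorm t.
Proof.
rewrite lt_def; apply/andP; split; last first.
  by rewrite /= !addr_ge0// -expr2 sqr_ge0.
apply/eqP => /= /eqP; rewrite -!expr2.
rewrite !paddr_eq0 ?addr_ge0 ?sqr_ge0// !sqrf_eq0.
move=> /andP[z0 /andP[]]; rewrite !subr_eq0 => /eqP x0 /eqP y0.
by move: z0; rewrite x0 y0 => /eqP; lra.
Qed.

Lemma enorm_neq0 t : reval enorm t != 0.
Proof. by rewrite gt_eqF ?enorm_gt0. Qed.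

Lemma ecollapse_wf j : rwf (ecollapse j).
Proof.
split; last by split; [|exact: enorm_neq0].
by case: ifP => _ //; case: ifP.
Qed.

Lemma ejacobian_wf : rwf ejacobian.
Proof. by do !split => //; exact: enorm_neq0. Qed.

Definition collapse := rmap ecollapse.

Lemma collapse_S2 t : S2 (collapse t).
Proof.
rewrite /S2 /= dot3E !mxE [ecollapse]lock /= -lock /ecollapse /=.
have := enorm_neq0 t; rewrite /=.
move: (_ * _ * t 0 1) (t 0 0 - _) (t 0 1 - _) => z x y n0.
by field.
Qed.

Lemma collapse_jacobian t :
  det3 (collapse t) ('D_(stdvec R 2 0) collapse t)
    ('D_(stdvec R 2 1) collapse t)
  = reval ejacobian t.
Proof.
rewrite /collapse !derive_rmap; do ?[exact: ecollapse_wf].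
have s00 : stdvec R 2 0 0 0 = 1 by rewrite mxE.
have s01 : stdvec R 2 0 0 1 = 0 by rewrite mxE.
have s10 : stdvec R 2 1 0 0 = 0 by rewrite mxE.
have s11 : stdvec R 2 1 0 1 = 1 by rewrite mxE.
rewrite /det3 dot3E !vec3E !mxE /=.
rewrite !s00 !s01 !s10 !s11.
have := enorm_neq0 t; rewrite /=.
(* The identity holds for arbitrary values of z and of its partial derivatives [z0] and [z1]. *)
move: (_ * _ * 0 + _) (_ * _ * 1 + _) => z0 z1.
move: (_ * _ * t 0 1) (t 0 0 - _) (t 0 1 - _) => z x y n0.
by field.
Qed.

Lemma ez_bary t : reval ez t = bary t 0 * bary t 1 * bary t 2.
Proof.
have t1 : tcoord t 1 = t 0 0 by rewrite /= insubT//=; congr (t 0 _);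
  apply: val_inj.
have t2 : tcoord t 2 = t 0 1 by rewrite /= insubT//=; congr (t 0 _);
  apply: val_inj.
have t3 : tcoord t 3 = 0 by rewrite /= insubF.
by rewrite /bary t1 t2 t3 /=; ring.
Qed.

(* In the barycentric coordinates a, b, c, the third factor is
   (ab + bc + ca)/3 - 2abc, and ab + bc + ca - 9abc is
   a(b-c)^2 + b(c-a)^2 + c(a-b)^2. *)
Lemma ejacobianE t : let a := 1 - t 0 0 in let b := t 0 0 - t 0 1 in
  let c := t 0 1 in
  reval ejacobian t = 4 * (a * b * c) *
    ((a * (b - c) ^+ 2 + b * (c - a) ^+ 2 + c * (a - b) ^+ 2) / 3 + a * b * c)
    / reval enorm t ^+ 2.
Proof.
move=> a b c; rewrite expr2 invfM /a /b /c.
have -> : reval ejacobian t = 4 * (reval ez t * (reval ez t + -1 *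
    (reval ex t * reval (rderiv (stdvec R 2 0) ez) t +
     reval ey t * reval (rderiv (stdvec R 2 1) ez) t))) *
    ((reval enorm t)^-1 * (reval enorm t)^-1) by [].
move: (reval enorm t)^-1 => q; rewrite /= !mxE /=.
move: (t 0 0) (t 0 1) => x y.
by field.
Qed.

Lemma ejacobian_ge0 t : Delta R 2 t -> 0 <= reval ejacobian t.
Proof.
move=> [t01 t10]; rewrite ejacobianE.
have /andP[_ ta] := t01 0; have /andP[tc _] := t01 1; have tb := t10 0 1 isT.
have := ltW (enorm_gt0 t); rewrite -subr_ge0 in ta; rewrite -subr_ge0 in tb.
move: ta tb tc; move: (1 - t 0 0) (t 0 0 - t 0 1) (t 0 1) (reval _ _) =>
  a b c n a0 b0 c0 n0.
by repeat first [done|exact: ler0n|exact: sqr_ge0|rewrite invr_ge0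
  |apply: addr_ge0|apply: mulr_ge0].
Qed.

(** Where z = 0, the point w / z lies at infinity, which corresponds to the pole of projection. *)
Lemma collapse_boundary t : reval ez t = 0 -> collapse t = vec3 0 0 (-1).
Proof.
move=> z0; have := enorm_neq0 t; rewrite /= => n0.
apply: eq_vec3; rewrite vec3E /collapse mxE /= in z0 n0 *; rewrite z0 in n0 *.
- by rewrite mul0r mulr0 mul0r.
- by rewrite mul0r mulr0 mul0r.
- by move: n0; rewrite mulr0 !add0r; move: (_ * _ + _ * _) => q q0; field.
Qed.

Lemma smooth_collapse :
  smooth_on (fun t : Delta R 2 => val t) setT (fun t : Delta R 2 =>
    collapse (val t)).
Proof.
move=> t _; exists collapse, setT; split=> //; first exact: openT.
exact/smooth_rmap/ecollapse_wf.
Qed.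

Definition collapse_pt t : S2 (R:=R) :=
  exist _ (collapse t) (mem_set (collapse_S2 t)).

Definition collapse_simplex : Sing R 2 :=
  exist _ (fun t : Delta R 2 => collapse_pt (val t)) smooth_collapse.

Lemma pole_S2 : S2 (vec3 0 0 (-1) : 'rV[R]_3).
Proof. by rewrite /S2 /= dot3E !vec3E; ring. Qed.

Lemma smooth_cst k (x : 'rV[R]_3) :
  smooth_on (fun t : Delta R k => val t) setT (fun=> x).
Proof.
move=> t _; exists (cst x), setT; split=> //; first exact: openT.
by move=> n; exact: is_Cn_cst.
Qed.

Definition cst_simplex k (x : S2 (R:=R)) : Sing R k :=
  exist _ (fun=> x) (smooth_cst (k := k) (val x)).

Definition pole : S2 (R:=R) := exist _ (vec3 0 0 (-1)) (mem_set pole_S2).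

(** A map [m] -> [2] with m < 2 misses some vertex [l]; the barycentric coordinate of index [l] then
    vanishes on its image, and so does z. *)
Lemma same_boundary_collapse :
  same_boundary collapse_simplex (cst_simplex 2 pole).
Proof.
move=> m f m2; apply: smooth_simplex_eq => t; apply: val_inj => /=.
apply: collapse_boundary; rewrite ez_bary !bary_aff.
have [l fl] : exists l : 'I_3, l \notin codom f.
  apply/existsP; rewrite -negb_forall; apply/negP => /forallP H.
  have : (#|'I_3| <= #|codom f|)%N.
    by apply/subset_leq_card/fintype.subsetP => l _; exact: H.
  by move=> /leq_trans /(_ (leq_image_card _ _));
    rewrite !card_ord ltnNge -ltnS => /negP; apply.
have : \sum_(i < m.+1) bary (val t) i * (f i == l :> nat)%:R = 0.
  rewrite big1// => i _; case: eqP => [fil|_]; last by rewrite mulr0.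
  by case/negP: fl; rewrite (_ : l = f i) ?codom_f//; apply: val_inj.
by case: l fl => [[|[|[|l]]]] //= _ _ ->; rewrite !(mul0r, mulr0).
Qed.

End collapse.

Lemma tangent_collapse (R : realType) (t v : 'rV[R]_2) :
  tangent (collapse_pt t) ('D_v (@collapse R) t).
Proof.
rewrite /tangent /= derive_rmap; last exact: ecollapse_wf.
rewrite dot3E !mxE /=; have := enorm_neq0 t; rewrite /=.
move: (_ * _ * v 0 1 + _) => z1.
move: (_ * _ * t 0 1) (t 0 0 - _) (t 0 1 - _) => z x y n0.
by field.
Qed.

(** * Integrals of the volume form over the two simplices *)

Section integrals.
Variables (R : realType) (eta : S2form R 2) (Heta : volume_form eta).
Let Hs := proj1 Heta.
Let I (s : Sing R 2) :=
  int_form (Delta R 2) (hpull_simplex s (Tagged (S2form R) eta)).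

Lemma int_cst_simplex x : I (cst_simplex 2 x) = 0.
Proof.
apply: null_int_form => t v; rewrite /= /pull_simplex; case: insub => // u.
rewrite [X in eta _ X](_ : _ = pair2 0 0); last first.
  apply/funext => i; rewrite (@tderiv_ext _ _ _ _ (cst (val x)))//.
    by rewrite derive_cst /pair2; case: ifP.
  by move=> n; exact: is_Cn_cst.
by apply: (form2_alt Hs); apply: tangent0.
Qed.

Let K t := density eta (collapse_pt t) * reval (ejacobian R) t.

Lemma continuous_reval m (e : rexpr R m) : rwf e ->
  continuous (reval e : 'rV[R]_m -> R^o).
Proof.
by move=> we t; apply/differentiable_continuous/differentiable_reval.
Qed.

Lemma continuous_collapse_pt : continuous (val \o @collapse_pt R).
Proof.
by move=> t; apply/differentiable_continuous/differentiable_rmap/ecollapse_wf.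
Qed.

Lemma pull_collapse t : Delta R 2 t ->
  pull_simplex (collapse_simplex R) eta t (fun i : 'I_2 => stdvec R 2 i) = K t.
Proof.
move=> Dt; rewrite /pull_simplex insubT; first exact: mem_set.
move=> Dt'; rewrite [X in eta _ X](_ : _ =
    pair2 ('D_(stdvec R 2 0) (@collapse R) t)
          ('D_(stdvec R 2 1) (@collapse R) t)).
  rewrite (_ : sval _ _ = collapse_pt t)//.
  by rewrite (form2_density Hs) ?collapse_jacobian//; apply: tangent_collapse.
have T v : tderiv (fun w => val (sval (collapse_simplex R) w)) (Sub t Dt') v =
    'D_v (@collapse R) t.
  by apply: tderiv_ext => //; exact/smooth_rmap/ecollapse_wf.
apply/funext => i; rewrite T /pair2.
case: ifPn => [/eqP -> //|i0]; rewrite (_ : nat_of_ord i = 1%N)//.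
by case: i i0 => [[|[|]]].
Qed.

Lemma continuous_K : continuous (K : 'rV[R]_2 -> R^o).
Proof.
have cd := @continuous_density _ _ Hs _ _ continuous_collapse_pt.
have cj := continuous_reval (ejacobian_wf R).
move=> t; exact: (continuousM (cd t) (cj t)).
Qed.

Lemma density_neq0 x : density eta x != 0.
Proof.
have [v vT] := proj2 Heta x; apply: contra_neq => d0.
have -> : v = pair2 (v 0) (v 1).
  apply/funext => i; rewrite /pair2; case: (i =P 0) => [->//|].
  by case: i => [[|[|i]]] //= i2 H; [case: H|congr v]; apply: val_inj.
by rewrite (form2_density Hs)// d0 mul0r.
Qed.

(* Intermediate value theorem along the segment from t to t'. *)
Lemma density_sign t t' : 0 < density eta (collapse_pt t) ->
  0 < density eta (collapse_pt t').
Proof.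
move=> t0; rewrite lt_def density_neq0 leNgt; apply/negP => t'0.
pose g (s : R) := s *: (t' - t) + t.
pose f (s : R) := density eta (collapse_pt (g s)).
have cg : continuous g.
  by move=> s; apply: cvgD; [apply: cvgZr_tmp; exact: cvg_id|exact: cvg_cst].
have cf : continuous (f : R -> R^o).
  apply: (continuous_density Hs (p := fun s => collapse_pt (g s))) => s.
  by apply: (continuous_comp (cg s)); apply: continuous_collapse_pt.
have f0 : f 0 = density eta (collapse_pt t) by rewrite /f /g scale0r add0r.
have f1 : f 1 = density eta (collapse_pt t') by rewrite /f /g scale1r subrK.
have [||c _ /eqP] := @IVT R f 0 1 0 ler01;
  last by rewrite (negbTE (density_neq0 _)).
  exact: continuous_subspaceT.
have /ltW tt' := lt_trans t'0 t0.
by rewrite f0 f1 min_r// max_l// (ltW t0) (ltW t'0).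
Qed.

Lemma bounded_K : exists M, forall t, cube R 2 t -> `|K t| <= M.
Proof.
have cc : compact (cube R 2).
  have -> : cube R 2 = [set t | forall i, `[0, 1]%classic (t ord0 i)].
    by apply/seteqP; split => t /= H i; have := H i; rewrite in_itv.
  by apply: (@rV_compact R 2 (fun=> `[0, 1]%classic)) => i;
    exact: segment_compact.
have [||c _ cM] := @compact_EVT_max _ R (fun t => `|K t|) (cube R 2) _ cc.
- by exists 0 => i; rewrite mxE lexx ler01.
- apply: continuous_subspaceT => t;
  apply: (continuous_comp (continuous_K (x := t))).
  exact: norm_continuous.
by exists `|K c| => t Dt; apply: cM; apply: mem_set.
Qed.

Let b := point2 (2 / 3 : R) (1 / 3).

Lemma ejacobian_barycenter : 0 < reval (ejacobian R) b.
Proof.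
rewrite ejacobianE divr_gt0 ?exprn_gt0 ?enorm_gt0// /b point2_0 point2_1.
by lra.
Qed.

Lemma near_barycenter (P : 'rV[R]_2 -> Prop) : (\forall t \near b, P t) ->
  exists2 e : R, 0 < e & forall x y : R,
    2 / 3 - e <= x <= 2 / 3 + e -> 1 / 3 - e <= y <= 1 / 3 + e ->
    Delta R 2 (point2 x y) /\ P (point2 x y).
Proof.
(* The bound 1/9 keeps all three barycentric coordinates, equal to 1/3 at the centre, positive; e /
   2 keeps the square inside the open ball. *)
move=> /nbhs_ballP[e /= e0 eP]; exists (Num.min (e / 2) (1 / 9)).
  by rewrite lt_min divr_gt0//=; lra.
have [de d9] : Num.min (e / 2) (1 / 9) < e /\ Num.min (e / 2) (1 / 9) <= 1 / 9.
  by rewrite gt_min ge_min lexx orbT; split=> //; apply/orP; left; lra.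
move: (Num.min _ _) de d9 => d de d9 x y /andP[xl xr] /andP[yl yr].
have E0 : point2 x y ord0 0 = x := point2_0 x y.
have E1 : point2 x y ord0 1 = y := point2_1 x y.
split; last first.
  apply: eP; split=> // i j; rewrite (ord1 i) {i}; move: j; apply: forall_ord2.
    by rewrite E0 point2_0 /ball /= ltr_norml; apply/andP; split; lra.
  by rewrite E1 point2_1 /ball /= ltr_norml; apply/andP; split; lra.
split; apply: forall_ord2; rewrite ?E0 ?E1; first by apply/andP; split; lra.
- by apply/andP; split; lra.
- by apply: forall_ord2 => _; rewrite ?E0 ?E1//; lra.
- by apply: forall_ord2 => //; rewrite ?E0 ?E1.
Qed.

(** The density has constant sign [c] along the collapse, and the Jacobian is nonnegative on the
    simplex and positive at the barycenter. Hence the integrand times [c] is nonnegative, and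
    exceeds half its central value on a small square. *)
Lemma int_collapse_simplex : I (collapse_simplex R) != 0.
Proof.
pose F t := \1_(Delta R 2) t * K t.
have -> : I (collapse_simplex R) = iterint F.
  apply: (etrans (int_formE _ (pull_simplex (collapse_simplex R) eta))).
  congr (iterint _); apply/funext => t; rewrite /F indicE.
  by case: (boolP (t \in Delta R 2)) => [/set_mem Dt|_];
    rewrite ?mul0r// -pull_collapse.
have [M KM] := bounded_K.
have Dcube t : Delta R 2 t -> cube R 2 t by case.
have M0 : 0 <= M.
  apply: (le_trans (normr_ge0 (K 0))); apply: KM => i.
  by rewrite mxE lexx ler01.
have bnd (c : R) : `|c| = 1 ->
  (forall t, 0 < c * density eta (collapse_pt t)) ->
    forall t, 0 <= c * F t <= M.
  move=> c1 dpos t; rewrite /F indicE;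
    case: (boolP (t \in _)) => [/set_mem Dt|_].
    rewrite mul1r; apply/andP; split.
      by rewrite mulrA mulr_ge0 ?ejacobian_ge0// ltW.
    by apply: (le_trans (ler_norm _)); rewrite normrM c1 mul1r; exact/KM/Dcube.
  by rewrite mul0r mulr0 lexx.
have pos (c : R) : `|c| = 1 ->
    (forall t, 0 < c * density eta (collapse_pt t)) ->
      0 < iterint (fun t => c * F t).
  move=> c1 dpos; have Kb : 0 < c * K b.
    by rewrite mulrA mulr_gt0 ?ejacobian_barycenter.
  have cK : {for b, continuous (fun t => c * K t : R^o)}.
    exact: (@continuousM _ _ (cst c) K b (@cst_continuous _ _ _ _)
      (continuous_K (x := b))).
  have [|e e0 bK] := @near_barycenter (fun t => c * K b / 2 < c * K t).
    have Kb2 : c * K b / 2 < c * K b by lra.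
    exact: (cvgr_gt _ cK _ Kb2).
  apply: (@iterint2_gt0 _ _ (c * K b / 2) M (2 / 3 - e) (2 / 3 + e) (1 / 3 - e)
    (1 / 3 + e)).
  - by rewrite divr_gt0.
  - lra.
  - lra.
  - exact: bnd.
  - move=> t; rewrite /F indicE; case: (boolP (t \in _)) => [/set_mem Dt _|_].
      exact: Dcube.
    by rewrite mul0r mulr0 eqxx.
  - move=> x y xe ye; have [Dxy Kxy] := bK x y xe ye.
    by rewrite /F indicE mem_set// mul1r ltW.
have [d0|d0|/eqP] := ltgtP (density eta (collapse_pt b)) 0; last first.
- by rewrite (negbTE (density_neq0 _)).
- have dpos t : 0 < 1 * density eta (collapse_pt t).
    by rewrite mul1r; exact: density_sign d0.
  have := pos 1 (normr1 _) dpos; rewrite (_ : (fun t => 1 * F t) = F).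
    by move=> /gt_eqF ->.
  by apply/funext => t; rewrite mul1r.
have dneg t : 0 < -1 * density eta (collapse_pt t).
  rewrite mulN1r oppr_gt0 lt_neqAle density_neq0 /= leNgt.
  by apply/negP => dt; have := @density_sign t b dt; rewrite ltNge (ltW d0).
have N1 : `|-1| = 1 :> R by rewrite normrN normr1.
have FN : F = (fun t => - (-1 * F t)) by apply/funext => t;
  rewrite mulN1r opprK.
(* For a negative density, the sign is moved out of the integral of a nonnegative function. *)
rewrite FN iterint2N ?oppr_eq0 ?gt_eqF ?pos// => t.
by have /andP[] := bnd _ N1 dneg t.
Qed.
End integrals.

(** * Comparison of the integration with pullbacks from the pair groupoid *)

Theorem proposition5p4 (R : realType) (eta : S2form R 2)
    (Heta : volume_form eta) :
  ~ exists F : groupoid_ruth R,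
      quasi_isomorphic
        (integration (vol_superconnection (proj1 Heta)))
        (pullback (pi_map R) (nerve_ruth F)).
Proof.
move=> [F EF]; have ss' := same_boundary_collapse R.
have /(quasi_isomorphic_defect ss' EF) H :=
  @integration_anticommutes _ _ (proj1 Heta) (collapse_simplex R)
    (cst_simplex 2 (pole R)).
have pi_eq : pi_map R 2%N (collapse_simplex R) =
  pi_map R 2%N (cst_simplex 2 (pole R)).
  (* Each vertex is the image under pi of a 0-dimensional face, so it is determined by the
     boundary. *)
  apply/funext => i; have E s : pi_map R 2%N s i =
      pi_map R 0%N (act (clip 0 2 (cst_homo i)) s) ord0.
    rewrite smap_nat /= /nerve_act /=; congr (vertices s _); apply: val_inj.
    by rewrite /= (minn_idPl (leq_ord i)) inordK.
  by rewrite !E ss'.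
case/negP: (int_collapse_simplex Heta); apply/eqP.
exact: (etrans (integration_defect (H (defect_trivial_pullback pi_eq)))
  (int_cst_simplex Heta _)).
Qed.
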